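(* Let $k$ be a positive integer. The analytic disc $\phi:\bar D\to\mathbb{C}^2$, $\phi(\zeta)=(\zeta,0)$, $|\zeta|\le1$, regarded as a disc attached to the real hypersurface $$M=\{(z_1,z_2)\in\mathbb{C}^2:\ \operatorname{Re}(z_1^kz_2)=0,\ z_1\neq0\},$$ has defect $d(\phi)=2k+1$.
   Context: $D\subset\mathbb{C}$ is the open unit disc and $\Gamma=\partial D$. The holomorphic co-normal bundle $CM$ of a generic real submanifold $M\subset\mathbb{C}^n$ has as fiber at $p\in M$ the real vector space of forms $\omega=\sum_{j=1}^n a_j\,dz_j$ ($a_j\in\mathbb{C}$) such that $\operatorname{Im}(\omega)$ vanishes on the real tangent space $T_pM$. Let $\phi:\bar D\to\mathbb{C}^n$ be of class $C^{1,\delta}$ ($0<\delta<1$), holomorphic in $D$, with $\phi(\Gamma)\subset M$ (a disc attached to $M$). A section $\sum_j a_j(\sigma)\,dz_j$ of $\phi^*CM\to\Gamma$ extends holomorphically to $D$ if every coefficient $a_j:\Gamma\to\mathbb{C}$ is the boundary value of a function continuous on $\bar D$ and holomorphic in $D$. The defect $d(\phi)$ is the dimension of the real vector space of all $C^{1,\delta}$-sections of $\phi^*CM$ which extend holomorphically to $D$. *)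

(* Defs.v *)
From Stdlib Require Import Reals.
From Coquelicot Require Import Coquelicot.
Open Scope R_scope.

(* [C] is a normed module over [C_AbsRing]
   (complex derivatives) and, as [C_R_NormedModule], over [R_AbsRing] (real
   derivatives).  [C2] is C^2 as a real normed space. *)
Definition C2 : NormedModule R_AbsRing :=
  prod_NormedModule R_AbsRing C_R_NormedModule C_R_NormedModule.

Definition open_disc (z : C) : Prop := Cmod z < 1.
Definition closed_disc (z : C) : Prop := Cmod z <= 1.

Definition circle : Type := {z : C | Cmod z = 1}.
Definition cpt (s : circle) : C := proj1_sig s.

Lemma Cmod_cis (t : R) : Cmod (cos t, sin t) = 1.
Proof.
unfold Cmod; simpl fst; simpl snd.
rewrite <- !Rsqr_pow2, Rplus_comm, sin2_cos2; exact sqrt_1.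
Qed.

Definition cis (t : R) : circle := exist _ (cos t, sin t) (Cmod_cis t).

(* The case [x = y] is excluded because [Rpower 0 delta = 1]. *)
Definition holder_on {U V : NormedModule R_AbsRing} (delta : R)
    (A : U -> Prop) (g : U -> V) : Prop :=
  exists K : R, forall x y : U, A x -> A y -> x <> y ->
    norm (minus (g x) (g y)) <= K * Rpower (norm (minus x y)) delta.

Definition continuous_within {U V : NormedModule R_AbsRing}
    (A : U -> Prop) (f : U -> V) : Prop :=
  forall x : U, A x -> filterlim f (within A (locally x)) (locally (f x)).

(* Only the values of [f] on the closed disc matter.  [L z] is the real
   differential of [f] at [z] for [z] in the open disc, and its continuous
   extension for [z] on the circle. *)
Definition C1holder_closed_disc {V : NormedModule R_AbsRing} (delta : R)
    (f : C_R_NormedModule -> V) : Prop :=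
  continuous_within closed_disc f /\
  exists L : C_R_NormedModule -> C_R_NormedModule -> V,
    (forall z, open_disc z -> filterdiff f (locally z) (L z)) /\
    (forall v, holder_on delta closed_disc (fun z => L z v)).

(* Regularity on the circle is regularity in the angular coordinate. *)
Definition C1holder_circle {V : NormedModule R_AbsRing} (delta : R)
    (a : circle -> V) : Prop :=
  exists b : R_NormedModule -> V,
    (forall t : R, is_derive (fun t => a (cis t)) t (b t)) /\
    holder_on delta (fun _ => True) b.

Definition holomorphic_disc (f : C -> C) : Prop :=
  forall z : C, open_disc z ->
    @ex_derive C_AbsRing C_NormedModule f z.

Definition extends_holomorphically (a : circle -> C) : Prop :=
  exists F : C_R_NormedModule -> C_R_NormedModule,
    continuous_within closed_disc F /\ holomorphic_disc F /\
    forall s : circle, F (cpt s) = a s.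

(* Class C^1; a real hypersurface of C^2 is automatically generic.  [drho q] is
   the real differential of the local defining function [rho] at [q]. *)
Definition real_hypersurface (M : C2 -> Prop) : Prop :=
  forall p : C2, M p ->
  exists (rho : C2 -> R_NormedModule) (drho : C2 -> C2 -> R_NormedModule),
    locally p (fun q =>
      (M q <-> rho q = 0) /\
      filterdiff rho (locally q) (drho q) /\
      forall v, continuous (fun q' => drho q' v) q) /\
    exists v, drho p v <> 0.

(* T_pM as the set of velocities at [p] of C^1 curves drawn in [M]. *)
Definition tangent_space (M : C2 -> Prop) (p v : C2) : Prop :=
  exists g g' : R -> C2,
    g 0 = p /\ g' 0 = v /\
    locally 0 (fun t => M (g t) /\ is_derive g t (g' t) /\ continuous g' t).

(* The form a_1 dz_1 + a_2 dz_2 is represented by the pair (a_1, a_2). *)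
Definition form_eval (a v : C2) : C :=
  (fst a * fst v + snd a * snd v)%C.

Definition conormal (M : C2 -> Prop) (p a : C2) : Prop :=
  forall v : C2, tangent_space M p v -> Im (form_eval a v) = 0.

Definition attached_disc (delta : R) (M : C2 -> Prop)
    (phi : C_R_NormedModule -> C2) : Prop :=
  C1holder_closed_disc delta phi /\
  holomorphic_disc (fun z => fst (phi z)) /\
  holomorphic_disc (fun z => snd (phi z)) /\
  forall s : circle, M (phi (cpt s)).

Definition defect_space (delta : R) (M : C2 -> Prop)
    (phi : C_R_NormedModule -> C2) (a : circle -> C2) : Prop :=
  (forall s : circle, conormal M (phi (cpt s)) (a s)) /\
  C1holder_circle delta a /\
  extends_holomorphically (fun s => fst (a s)) /\
  extends_holomorphically (fun s => snd (a s)).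

(* [E], a set of [V]-valued functions on [X], is a real vector space with basis
   [e 1], ..., [e n]; for [n = 0] the sums are empty. *)
Definition has_real_dim {X : Type} {V : ModuleSpace R_Ring}
    (E : (X -> V) -> Prop) (n : nat) : Prop :=
  exists e : nat -> X -> V,
    (forall a : X -> V, E a <->
       exists c : nat -> R,
         forall x, a x = sum_n_m (fun i => scal (c i) (e i x)) 1 n) /\
    (forall c : nat -> R,
       (forall x, sum_n_m (fun i => scal (c i) (e i x)) 1 n = zero) ->
       forall i, (1 <= i <= n)%nat -> c i = 0).

(* [has_defect delta M phi d] states d(phi) = d. *)
Definition has_defect (delta : R) (M : C2 -> Prop)
    (phi : C_R_NormedModule -> C2) (d : nat) : Prop :=
  has_real_dim (defect_space delta M phi) d.

Definition Mk (k : nat) (z : C2) : Prop :=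
  Re ((fst z : C) ^ k * snd z)%C = 0 /\ fst z <> RtoC 0.

Definition flat_disc (z : C_R_NormedModule) : C2 := (z, RtoC 0).

(* Main.v *)
Require Import Defs.
From Stdlib Require Import Reals.
From Coquelicot Require Import Coquelicot.
From Stdlib Require Import Lra Lia Classical ClassicalEpsilon FunctionalExtensionality.
Open Scope R_scope.

(** The disc is flat, so the co-normal bundle along it can be computed by hand: at
    [(s, 0)] with [|s| = 1] the tangent space of [M] is [Re (s^k v2) = 0], and a form
    [a1 dz1 + a2 dz2] is co-normal exactly when [a1 = 0] and [a2 = i c s^k] with [c]
    real ([conormal_Mk_flat]).  The defect therefore counts the real functions [c] on
    the circle for which [i c s^k] has a holomorphic extension [F] to the disc.

    That [c] is real means [F = - conj F * s^(2k)] on the circle: in terms of Fourier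
    coefficients, the coefficient of index [j] is minus the conjugate of that of index
    [2k - j].  The negative ones vanish because [F] is holomorphic, hence so do those
    of index above [2k], and [F] is a polynomial of degree at most [2k].  To avoid
    Fourier uniqueness, this is read off the Cauchy formula
    [F z = mean of F(u) / (1 - z conj u)]: expanding the kernel as a geometric sum up to
    order [2k] leaves a remainder which, by the symmetry, is the conjugate of the mean
    of a holomorphic function vanishing at [0], hence zero
    ([fourier_expansion_disc], [fourier_expansion_circle]).  So [c] is a real
    trigonometric polynomial of degree at most [k].  Conversely, if [c] is the sum of
    [Re (g_m s^m)] for [m <= k], then [i c s^k] is [i/2] times the sum of
    [g_m s^(k+m) + conj g_m s^(k-m)], a polynomial in [s].  The
    functions [1], [Re s^m], [Im s^m] for [1 <= m <= k] are orthogonal, which gives the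
    dimension [2k + 1].

    The function theory needed is the mean value property, for functions whose complex
    derivative is only known to exist.  It comes from a form of Goursat's theorem in
    real variables ([goursat_green]): a form [P dx + Q dy] with pointwise
    [dP/dy = dQ/dx] integrates to zero over the boundary of a rectangle.  In the
    coordinates [(x, y)] with [z = e^x (cos y, sin y)], a rectangle with sides
    [ln r, ln r'] and [0, 2 pi] covers an annulus and its horizontal sides cancel by
    periodicity, so that circle means do not depend on the radius
    ([circle_integral_const]).  Since circle means are also continuous in the radius, a
    whole circle on which differentiability is unknown does no harm ([mean_value]),
    and the Cauchy formula follows by applying the mean value property to
    [(F w - F z) w / (w - z)], which is continuous but not visibly differentiable at
    [z] ([cauchy_formula]). *)

(** * Goursat's theorem for closed forms on a rectangle *)

(** Nested bisection as an induction principle: if [P] failed on the initial box it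
    would fail on a sequence of boxes halved at each step, and these shrink to a point
    near which [P] holds.  The box with corner [(x, y)] and scale [s] has sides [s * w]
    and [s * h], so every box keeps the proportions of the first one; without this
    the area would not control the square of the diameter. *)
Lemma quadtree_induction (P : R -> R -> R -> Prop) (a c w h : R) :
  0 <= w -> 0 <= h ->
  (forall x y s, P x y (s / 2) -> P (x + s / 2 * w) y (s / 2) ->
     P x (y + s / 2 * h) (s / 2) -> P (x + s / 2 * w) (y + s / 2 * h) (s / 2) ->
     P x y s) ->
  (forall x0 y0, a <= x0 <= a + w -> c <= y0 <= c + h ->
     exists d : posreal, forall x y s, 0 < s < d ->
       x <= x0 <= x + s * w -> y <= y0 <= y + s * h -> P x y s) ->
  P a c 1.
Proof.
intros Hw Hh Hsplit Hloc.
apply NNPP; intros Hbad.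
pose (sc := fun n : nat => (/ 2) ^ n).
assert (Hsc : forall n, 0 < sc n) by (intros n; apply pow_lt; lra).
assert (HscS : forall n, sc (S n) = sc n / 2) by (intros n; unfold sc; simpl; field).
pose (bad := fun n (p : R * R) => ~ P (fst p) (snd p) (sc n)).
assert (step : forall n p, { p' : R * R | bad n p -> bad (S n) p' /\
   fst p <= fst p' <= fst p + sc n / 2 * w /\
   snd p <= snd p' <= snd p + sc n / 2 * h }).
{ intros n [x y]. apply constructive_indefinite_description.
  destruct (classic (bad n (x, y))) as [B | B]; [ | exists (x, y); tauto].
  unfold bad in *; simpl in *.
  assert (W : 0 <= sc n / 2 * w) by (apply Rmult_le_pos; [specialize (Hsc n) |]; lra).
  assert (H : 0 <= sc n / 2 * h) by (apply Rmult_le_pos; [specialize (Hsc n) |]; lra).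
  apply NNPP; intros N; apply B; apply Hsplit; rewrite <- HscS; apply NNPP; intros M; apply N.
  - exists (x, y); simpl; intuition lra.
  - exists (x + sc n / 2 * w, y); simpl; rewrite <- HscS in *; intuition lra.
  - exists (x, y + sc n / 2 * h); simpl; rewrite <- HscS in *; intuition lra.
  - exists (x + sc n / 2 * w, y + sc n / 2 * h); simpl; rewrite <- HscS in *; intuition lra. }
pose (f := nat_rect (fun _ => (R * R)%type) (a, c) (fun n p => proj1_sig (step n p))).
assert (fS : forall n, f (S n) = proj1_sig (step n (f n))) by reflexivity.
assert (Hf : forall n, bad n (f n)).
{ induction n as [|n IH].
  - unfold bad, sc; simpl; exact Hbad.
  - rewrite fS. exact (proj1 (proj2_sig (step n (f n)) IH)). }
assert (Hchild : forall n, fst (f n) <= fst (f (S n)) <= fst (f n) + sc n / 2 * w /\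
   snd (f n) <= snd (f (S n)) <= snd (f n) + sc n / 2 * h).
{ intros n; rewrite fS. exact (proj2 (proj2_sig (step n (f n)) (Hf n))). }
assert (Hsc0 : is_lim_seq sc 0).
{ apply is_lim_seq_geom. rewrite Rabs_pos_eq; lra. }
assert (squeeze : forall (u : nat -> R) l, 0 <= l ->
  (forall n, u n <= u (S n) <= u n + sc n / 2 * l) ->
  exists X, forall n, u n <= X <= u n + sc n * l).
{ intros u l Hl Hu.
  assert (Hadj := ex_lim_seq_adj u (fun n => u n + sc n * l)).
  destruct Hadj as [[X HX] [[Y HY] HXY]].
  - intros n; apply Hu.
  - intros n; rewrite HscS. specialize (Hu n). nra.
  - apply is_lim_seq_ext with (fun n => l * sc n); [intros; ring |].
    replace (Finite 0) with (Rbar_mult (Finite l) (Finite 0)) by (simpl; f_equal; ring).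
    now apply is_lim_seq_scal_l.
  - exists X; intros n.
    rewrite (is_lim_seq_unique _ _ HX), (is_lim_seq_unique _ _ HY) in HXY.
    injection HXY as <-.
    split.
    + apply (is_lim_seq_incr_compare _ _ HX). intros m; apply Hu.
    + apply (is_lim_seq_decr_compare _ _ HY).
      intros m; rewrite HscS. specialize (Hu m). nra. }
destruct (squeeze (fun n => fst (f n)) w Hw (fun n => proj1 (Hchild n))) as [X HX].
destruct (squeeze (fun n => snd (f n)) h Hh (fun n => proj2 (Hchild n))) as [Y HY].
destruct (Hloc X Y) as [d Hd].
{ specialize (HX 0%nat); unfold sc in HX; simpl in HX; lra. }
{ specialize (HY 0%nat); unfold sc in HY; simpl in HY; lra. }
assert (Hn : exists n, sc n < d).
{ apply is_lim_seq_spec in Hsc0. destruct (Hsc0 d) as [n Hn].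
  exists n. specialize (Hn n (Nat.le_refl n)). rewrite Rminus_0_r in Hn.
  rewrite Rabs_pos_eq in Hn; [exact Hn | left; apply Hsc]. }
destruct Hn as [n Hn].
apply (Hf n). apply Hd; auto.
Qed.

(** The integral of [P dx + Q dy] over the positively oriented boundary. *)
Definition rect_integral (P Q : R -> R -> R) (a b c d : R) : R :=
  RInt (fun x => P x c - P x d) a b + RInt (fun y => Q b y - Q a y) c d.

Lemma continuity_2d_pt_slice_x (f : R -> R -> R) x y :
  continuity_2d_pt f x y -> continuous (fun x => f x y) x.
Proof.
intros H. apply continuity_2d_pt_filterlim in H.
apply (filterlim_comp _ _ _ (fun x => (x, y)) (fun z => f (fst z) (snd z)) _ (locally (x, y))).
2: exact H.
intros A [e He]; exists e; intros x' Hx'. apply He; split; [exact Hx' | apply ball_center].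
Qed.

Lemma continuity_2d_pt_slice_y (f : R -> R -> R) x y :
  continuity_2d_pt f x y -> continuous (fun y => f x y) y.
Proof.
intros H. apply continuity_2d_pt_filterlim in H.
apply (filterlim_comp _ _ _ (fun y => (x, y)) (fun z => f (fst z) (snd z)) _ (locally (x, y))).
2: exact H.
intros A [e He]; exists e; intros x' Hx'. apply He; split; [apply ball_center | exact Hx'].
Qed.

Definition continuous_on_box (f : R -> R -> R) (a b c d : R) : Prop :=
  forall x y, a <= x <= b -> c <= y <= d -> continuity_2d_pt f x y.

Lemma ex_RInt_slice_x f a b c d y :
  a <= b -> c <= y <= d -> continuous_on_box f a b c d ->
  ex_RInt (fun x => f x y) a b.
Proof.
intros Hab Hy Hf. apply (@ex_RInt_continuous R_CompleteNormedModule).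
rewrite Rmin_left, Rmax_right by lra. intros x Hx.
apply continuity_2d_pt_slice_x. now apply Hf.
Qed.

Lemma ex_RInt_slice_y f a b c d x :
  c <= d -> a <= x <= b -> continuous_on_box f a b c d ->
  ex_RInt (fun y => f x y) c d.
Proof.
intros Hcd Hx Hf. apply (@ex_RInt_continuous R_CompleteNormedModule).
rewrite Rmin_left, Rmax_right by lra. intros y Hy.
apply continuity_2d_pt_slice_y. now apply Hf.
Qed.

Lemma continuous_on_box_sub f a b c d a' b' c' d' :
  a <= a' -> b' <= b -> c <= c' -> d' <= d ->
  continuous_on_box f a b c d -> continuous_on_box f a' b' c' d'.
Proof. intros ? ? ? ? Hf x y Hx Hy; apply Hf; lra. Qed.

Lemma rect_integral_split_x P Q a m b c d :
  a <= m <= b -> c <= d ->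
  continuous_on_box P a b c d -> continuous_on_box Q a b c d ->
  rect_integral P Q a b c d = rect_integral P Q a m c d + rect_integral P Q m b c d.
Proof.
intros Hm Hcd HP HQ. unfold rect_integral.
assert (EP : forall u v, a <= u -> u <= v -> v <= b -> ex_RInt (fun x => P x c - P x d) u v).
{ intros u v Hu Huv Hv.
  apply (ex_RInt_minus (V := R_NormedModule)); eapply ex_RInt_slice_x with (c := c) (d := d);
    try lra; eapply continuous_on_box_sub; try exact HP; lra. }
assert (EQ : forall x x', a <= x <= b -> a <= x' <= b -> ex_RInt (fun y => Q x y - Q x' y) c d).
{ intros x x' Hx Hx'.
  apply (ex_RInt_minus (V := R_NormedModule)); eapply ex_RInt_slice_y with (a := a) (b := b);
    try lra; eapply continuous_on_box_sub; try exact HQ; lra. }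
rewrite <- (RInt_Chasles (fun x => P x c - P x d) a m b) by (apply EP; lra).
rewrite (RInt_ext (fun y => Q b y - Q a y) (fun y => plus (Q m y - Q a y) (Q b y - Q m y)))
  by (intros; change plus with Rplus; simpl; ring).
rewrite (RInt_plus (fun y => Q m y - Q a y)) by (apply EQ; lra).
change plus with Rplus; simpl; ring.
Qed.

Lemma rect_integral_split_y P Q a b c m d :
  a <= b -> c <= m <= d ->
  continuous_on_box P a b c d -> continuous_on_box Q a b c d ->
  rect_integral P Q a b c d = rect_integral P Q a b c m + rect_integral P Q a b m d.
Proof.
intros Hab Hm HP HQ. unfold rect_integral.
assert (EP : forall y y', c <= y <= d -> c <= y' <= d -> ex_RInt (fun x => P x y - P x y') a b).
{ intros y y' Hy Hy'.
  apply (ex_RInt_minus (V := R_NormedModule)); eapply ex_RInt_slice_x with (c := c) (d := d);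
    try lra; eapply continuous_on_box_sub; try exact HP; lra. }
assert (EQ : forall u v, c <= u -> u <= v -> v <= d -> ex_RInt (fun y => Q b y - Q a y) u v).
{ intros u v Hu Huv Hv.
  apply (ex_RInt_minus (V := R_NormedModule)); eapply ex_RInt_slice_y with (a := a) (b := b);
    try lra; eapply continuous_on_box_sub; try exact HQ; lra. }
rewrite <- (RInt_Chasles (fun y => Q b y - Q a y) c m d) by (apply EQ; lra).
rewrite (RInt_ext (fun x => P x c - P x d) (fun x => plus (P x c - P x m) (P x m - P x d)))
  by (intros; change plus with Rplus; simpl; ring).
rewrite (RInt_plus (fun x => P x c - P x m)) by (apply EP; lra).
change plus with Rplus; simpl; ring.
Qed.

(** Near a point of differentiability with [dP/dy = dQ/dx = D], the affine parts of
    [P] and [Q] integrate to zero and the remainder is small compared with diameter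
    times perimeter. *)
Lemma rect_integral_small P Q x0 y0 Px D Qy (eps : R) :
  0 < eps ->
  differentiable_pt_lim P x0 y0 Px D -> differentiable_pt_lim Q x0 y0 D Qy ->
  exists d : posreal, forall a b c e,
    a <= x0 <= b -> c <= y0 <= e -> b - a < d -> e - c < d ->
    continuous_on_box P a b c e -> continuous_on_box Q a b c e ->
    Rabs (rect_integral P Q a b c e) <= eps * ((b - a) + (e - c)) ^ 2.
Proof.
intros Heps HP HQ.
assert (He2 : 0 < eps / 2) by lra.
destruct (HP (mkposreal _ He2)) as [d1 H1]. destruct (HQ (mkposreal _ He2)) as [d2 H2].
simpl in H1, H2.
exists (mkposreal _ (Rmin_stable_in_posreal d1 d2)). simpl.
intros a b c e Hx Hy Hw Hh CP CQ.
assert (Hd1 := Rmin_l d1 d2). assert (Hd2 := Rmin_r d1 d2).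
set (M := (b - a) + (e - c)).
assert (HM : forall x y, a <= x <= b -> c <= y <= e ->
  Rabs (x - x0) < d1 /\ Rabs (y - y0) < d1 /\ Rabs (x - x0) < d2 /\ Rabs (y - y0) < d2 /\
  Rmax (Rabs (x - x0)) (Rabs (y - y0)) <= M).
{ intros x y Hx' Hy'. unfold M.
  assert (Rabs (x - x0) <= b - a) by (apply Rabs_le; lra).
  assert (Rabs (y - y0) <= e - c) by (apply Rabs_le; lra).
  repeat split; try lra. apply Rmax_lub; lra. }
assert (BP : forall x, a <= x <= b -> Rabs (P x c - P x e + D * (e - c)) <= eps * M).
{ intros x Hx'.
  destruct (HM x c Hx') as (A1 & A2 & _ & _ & A3); [lra |].
  destruct (HM x e Hx') as (B1 & B2 & _ & _ & B3); [lra |].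
  assert (I1 := H1 x c A1 A2). assert (I2 := H1 x e B1 B2).
  replace (P x c - P x e + D * (e - c)) with
    ((P x c - P x0 y0 - (Px * (x - x0) + D * (c - y0))) -
     (P x e - P x0 y0 - (Px * (x - x0) + D * (e - y0)))) by ring.
  eapply Rle_trans; [apply Rabs_triang |]. rewrite Rabs_Ropp.
  apply (Rmult_le_compat_l (eps / 2)) in A3; [| lra].
  apply (Rmult_le_compat_l (eps / 2)) in B3; [| lra]. lra. }
assert (BQ : forall y, c <= y <= e -> Rabs (Q b y - Q a y - D * (b - a)) <= eps * M).
{ intros y Hy'.
  destruct (HM a y) as (_ & _ & A1 & A2 & A3); [lra | lra |].
  destruct (HM b y) as (_ & _ & B1 & B2 & B3); [lra | lra |].
  assert (I1 := H2 a y A1 A2). assert (I2 := H2 b y B1 B2).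
  replace (Q b y - Q a y - D * (b - a)) with
    ((Q b y - Q x0 y0 - (D * (b - x0) + Qy * (y - y0))) -
     (Q a y - Q x0 y0 - (D * (a - x0) + Qy * (y - y0)))) by ring.
  eapply Rle_trans; [apply Rabs_triang |]. rewrite Rabs_Ropp.
  apply (Rmult_le_compat_l (eps / 2)) in A3; [| lra].
  apply (Rmult_le_compat_l (eps / 2)) in B3; [| lra]. lra. }
assert (EP : ex_RInt (fun x => P x c - P x e) a b).
{ apply (ex_RInt_minus (V := R_NormedModule)); eapply ex_RInt_slice_x with (c := c) (d := e);
    try lra; exact CP. }
assert (EQ : ex_RInt (fun y => Q b y - Q a y) c e).
{ apply (ex_RInt_minus (V := R_NormedModule)); eapply ex_RInt_slice_y with (a := a) (b := b);
    try lra; exact CQ. }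
(* the affine parts contribute [D] times the area with opposite signs *)
assert (R1 : RInt (fun x => P x c - P x e + D * (e - c)) a b =
  RInt (fun x => P x c - P x e) a b + D * (e - c) * (b - a)).
{ rewrite (RInt_plus (V := R_CompleteNormedModule) (fun x => P x c - P x e) (fun _ => D * (e - c)));
   [ | exact EP | apply ex_RInt_const].
  rewrite RInt_const. unfold scal; simpl; unfold mult; simpl. unfold plus; simpl. ring. }
assert (R2 : RInt (fun y => Q b y - Q a y - D * (b - a)) c e =
  RInt (fun y => Q b y - Q a y) c e - D * (e - c) * (b - a)).
{ rewrite (RInt_minus (V := R_CompleteNormedModule) (fun y => Q b y - Q a y) (fun _ => D * (b - a)));
   [ | exact EQ | apply ex_RInt_const].
  rewrite RInt_const. unfold scal; simpl; unfold mult; simpl. unfold minus, plus, opp; simpl. ring. }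
unfold rect_integral.
replace (RInt (fun x => P x c - P x e) a b + RInt (fun y => Q b y - Q a y) c e) with
  (RInt (fun x => P x c - P x e + D * (e - c)) a b + RInt (fun y => Q b y - Q a y - D * (b - a)) c e)
  by (rewrite R1, R2; ring).
eapply Rle_trans; [apply Rabs_triang |].
assert (S1 : Rabs (RInt (fun x => P x c - P x e + D * (e - c)) a b) <= (b - a) * (eps * M)).
{ apply abs_RInt_le_const; [lra | | exact BP].
  apply (ex_RInt_plus (V := R_NormedModule)); [exact EP | apply ex_RInt_const]. }
assert (S2 : Rabs (RInt (fun y => Q b y - Q a y - D * (b - a)) c e) <= (e - c) * (eps * M)).
{ apply abs_RInt_le_const; [lra | | exact BQ].
  apply (ex_RInt_minus (V := R_NormedModule)); [exact EQ | apply ex_RInt_const]. }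
apply Rle_trans with ((b - a) * (eps * M) + (e - c) * (eps * M)).
- now apply Rplus_le_compat.
- right; unfold M; ring.
Qed.

(** Goursat's argument: by bisection the bound of [rect_integral_small] propagates
    from small boxes to the whole one, because the squares of the sizes of the four
    quarters of a box add up to the square of its own size.  So the integral over the
    whole box is smaller than any positive number. *)
Theorem goursat_green P Q a b c d :
  a <= b -> c <= d ->
  (forall x y, a <= x <= b -> c <= y <= d -> exists Px D Qy,
     differentiable_pt_lim P x y Px D /\ differentiable_pt_lim Q x y D Qy) ->
  rect_integral P Q a b c d = 0.
Proof.
intros Hab Hcd HPQ.
assert (CP : continuous_on_box P a b c d).
{ intros x y Hx Hy. destruct (HPQ x y Hx Hy) as (Px & D & Qy & HP & _).
  apply differentiable_continuity_pt. now exists Px, D. }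
assert (CQ : continuous_on_box Q a b c d).
{ intros x y Hx Hy. destruct (HPQ x y Hx Hy) as (Px & D & Qy & _ & HQ).
  apply differentiable_continuity_pt. now exists D, Qy. }
set (w := b - a). set (h := d - c).
assert (Key : forall eps, 0 < eps -> Rabs (rect_integral P Q a b c d) <= eps * (w + h) ^ 2).
{ intros eps Heps.
  pose (good := fun x y s => a <= x -> x + s * w <= b -> c <= y -> y + s * h <= d -> 0 <= s ->
    Rabs (rect_integral P Q x (x + s * w) y (y + s * h)) <= eps * (s * w + s * h) ^ 2).
  assert (G : good a c 1).
  { apply quadtree_induction with (w := w) (h := h); [unfold w; lra | unfold h; lra | |].
    - intros x y s G1 G2 G3 G4 B1 B2 B3 B4 B5. unfold good in *.
      assert (W : 0 <= s / 2 * w) by (apply Rmult_le_pos; unfold w; lra).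
      assert (H : 0 <= s / 2 * h) by (apply Rmult_le_pos; unfold h; lra).
      replace (x + s * w) with (x + s / 2 * w + s / 2 * w) in * by field.
      replace (y + s * h) with (y + s / 2 * h + s / 2 * h) in * by field.
      rewrite (rect_integral_split_x P Q x (x + s / 2 * w)); try lra;
        [ | eapply continuous_on_box_sub; try exact CP; lra
          | eapply continuous_on_box_sub; try exact CQ; lra].
      rewrite (rect_integral_split_y P Q x (x + s / 2 * w) y (y + s / 2 * h)); try lra;
        [ | eapply continuous_on_box_sub; try exact CP; lra
          | eapply continuous_on_box_sub; try exact CQ; lra].
      rewrite (rect_integral_split_y P Q (x + s / 2 * w) (x + s / 2 * w + s / 2 * w) y (y + s / 2 * h)); try lra;
        [ | eapply continuous_on_box_sub; try exact CP; lra
          | eapply continuous_on_box_sub; try exact CQ; lra].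
      replace (eps * (s * w + s * h) ^ 2) with
        (eps * (s / 2 * w + s / 2 * h) ^ 2 + eps * (s / 2 * w + s / 2 * h) ^ 2 +
        (eps * (s / 2 * w + s / 2 * h) ^ 2 + eps * (s / 2 * w + s / 2 * h) ^ 2)) by field.
      eapply Rle_trans; [apply Rabs_triang |].
      apply Rplus_le_compat; (eapply Rle_trans; [apply Rabs_triang |]; apply Rplus_le_compat).
      + apply G1; lra.
      + apply G3; lra.
      + apply G2; lra.
      + apply G4; lra.
    - intros x0 y0 Hx0 Hy0.
      destruct (HPQ x0 y0) as (Px & D & Qy & HP & HQ); [unfold w in *; lra | unfold h in *; lra |].
      destruct (rect_integral_small P Q x0 y0 Px D Qy eps Heps HP HQ) as [dl Hdl].
      assert (Hwh : 0 < w + h + 1) by (unfold w, h; lra).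
      assert (Hd : 0 < dl / (w + h + 1)) by (apply Rdiv_lt_0_compat; [apply cond_pos | exact Hwh]).
      exists (mkposreal _ Hd); simpl.
      intros x y s Hs Hx Hy B1 B2 B3 B4 B5.
      replace (s * w + s * h) with ((x + s * w - x) + (y + s * h - y)) by ring.
      assert (Hsl : s * (w + h + 1) < dl).
      { apply Rlt_le_trans with (dl / (w + h + 1) * (w + h + 1)).
        - apply Rmult_lt_compat_r; lra.
        - right; field; lra. }
      assert (0 <= s * w) by (apply Rmult_le_pos; unfold w; lra).
      assert (0 <= s * h) by (apply Rmult_le_pos; unfold h; lra).
      apply Hdl; try lra.
      + eapply continuous_on_box_sub; try exact CP; lra.
      + eapply continuous_on_box_sub; try exact CQ; lra. }
  unfold good in G. rewrite !Rmult_1_l in G.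
  replace (a + w) with b in G by (unfold w; ring).
  replace (c + h) with d in G by (unfold h; ring).
  apply G; lra. }
apply Rabs_eq_0. apply Rle_antisym; [| apply Rabs_pos].
apply le_epsilon. intros eps Heps. rewrite Rplus_0_l.
assert (Hp : 0 < (w + h) ^ 2 + 1) by (assert (0 <= (w + h) ^ 2) by apply pow2_ge_0; lra).
eapply Rle_trans; [apply (Key (eps / ((w + h) ^ 2 + 1))); now apply Rdiv_lt_0_compat |].
assert (0 <= (w + h) ^ 2) by apply pow2_ge_0.
apply Rle_trans with (eps / ((w + h) ^ 2 + 1) * ((w + h) ^ 2 + 1)).
- apply Rmult_le_compat_l; [left; now apply Rdiv_lt_0_compat | lra].
- right; field; lra.
Qed.

(** * Limits and derivatives in the complex plane *)

Lemma Cminus_neq_0 (w z : C) : w <> z -> (w - z)%C <> RtoC 0.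
Proof.
intros N E. apply N. replace w with ((w - z) + z)%C by ring. rewrite E; ring.
Qed.

Lemma im_le_Cmod (z : C) : Rabs (Im z) <= Cmod z.
Proof. eapply Rle_trans; [apply (Rmax_r (Rabs (fst z))) | apply Rmax_Cmod]. Qed.

(** Convergence is measured by the modulus, whatever the filter: the same rules then
    serve for difference quotients in the plane, for limits within the closed disc and
    for curves with a real parameter. *)
Definition climit {T : Type} (F : (T -> Prop) -> Prop) (f : T -> C) (l : C) : Prop :=
  forall eps, 0 < eps -> F (fun x => Cmod (f x - l) < eps).

Section ClimitAlgebra.
Context {T : Type} {F : (T -> Prop) -> Prop} {FF : Filter F}.

Lemma climit_ext_loc f g l : F (fun x => f x = g x) -> climit F f l -> climit F g l.
Proof.
intros E Hf eps He. generalize (filter_and _ _ E (Hf eps He)). apply filter_imp.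
intros x [<- H]; exact H.
Qed.

Lemma climit_ext f g l : (forall x, f x = g x) -> climit F f l -> climit F g l.
Proof. intros E; apply climit_ext_loc; now apply filter_forall. Qed.

Lemma climit_const c : climit F (fun _ => c) c.
Proof.
intros eps He. apply filter_forall; intros x.
replace (c - c)%C with (RtoC 0) by ring. now rewrite Cmod_0.
Qed.

Lemma climit_plus f g l m : climit F f l -> climit F g m -> climit F (fun x => f x + g x)%C (l + m)%C.
Proof.
intros Hf Hg eps He. assert (He2 : 0 < eps / 2) by lra.
generalize (filter_and _ _ (Hf _ He2) (Hg _ He2)). apply filter_imp. intros x [A B].
replace (f x + g x - (l + m))%C with ((f x - l) + (g x - m))%C by ring.
eapply Rle_lt_trans; [apply Cmod_triangle | lra].
Qed.

Lemma climit_mult f g l m : climit F f l -> climit F g m -> climit F (fun x => f x * g x)%C (l * m)%C.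
Proof.
intros Hf Hg eps He.
assert (Pl := Cmod_ge_0 l). assert (Pm := Cmod_ge_0 m).
set (D := Cmod l + Cmod m + 1).
assert (HD : 1 <= D) by (unfold D; lra).
assert (He2 : 0 < Rmin 1 (eps / (2 * D))).
{ apply Rmin_glb_lt; [lra | apply Rdiv_lt_0_compat; lra]. }
generalize (filter_and _ _ (Hf _ He2) (Hg _ He2)). apply filter_imp. intros x [A B].
replace (f x * g x - l * m)%C with ((f x - l) * (g x - m) + (l * (g x - m) + m * (f x - l)))%C by ring.
eapply Rle_lt_trans; [apply Cmod_triangle |].
eapply Rle_lt_trans; [apply Rplus_le_compat_l, Cmod_triangle |].
rewrite !Cmod_mult.
set (u := Cmod (f x - l)) in *. set (v := Cmod (g x - m)) in *.
assert (0 <= u) by apply Cmod_ge_0. assert (0 <= v) by apply Cmod_ge_0.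
assert (M1 := Rmin_l 1 (eps / (2 * D))). assert (M2 := Rmin_r 1 (eps / (2 * D))).
set (d := Rmin 1 (eps / (2 * D))) in *.
assert (d * (2 * D) <= eps).
{ apply Rle_trans with (eps / (2 * D) * (2 * D)); [apply Rmult_le_compat_r; lra | right; field; lra]. }
apply Rle_lt_trans with (D * d); [unfold D; nra | nra].
Qed.

Lemma climit_opp f l : climit F f l -> climit F (fun x => - f x)%C (- l)%C.
Proof.
intros Hf eps He. generalize (Hf eps He). apply filter_imp; intros x A.
replace (- f x - - l)%C with (- (f x - l))%C by ring. now rewrite Cmod_opp.
Qed.

Lemma climit_minus f g l m : climit F f l -> climit F g m -> climit F (fun x => f x - g x)%C (l - m)%C.
Proof. intros Hf Hg. apply climit_plus; [exact Hf | now apply climit_opp]. Qed.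

Lemma climit_conj f l : climit F f l -> climit F (fun x => Cconj (f x)) (Cconj l).
Proof.
intros Hf eps He. generalize (Hf eps He). apply filter_imp; intros x A.
now rewrite <- Cminus_conj, Cmod_conj.
Qed.

Lemma climit_pow f l n : climit F f l -> climit F (fun x => f x ^ n)%C (l ^ n)%C.
Proof.
intros Hf. induction n as [|n IH]; [exact (climit_const (RtoC 1)) | exact (climit_mult _ _ _ _ Hf IH)].
Qed.

Lemma climit_nonzero f l : l <> RtoC 0 -> climit F f l -> F (fun x => Cmod l / 2 < Cmod (f x)).
Proof.
intros Hl Hf. assert (0 < Cmod l) by now apply Cmod_gt_0.
generalize (Hf (Cmod l / 2)%R ltac:(lra)). apply filter_imp. intros x A.
assert (B := Cmod_triangle (f x) (l - f x)%C).
replace (f x + (l - f x))%C with l in B by ring.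
replace (l - f x)%C with (- (f x - l))%C in B by ring. rewrite Cmod_opp in B. lra.
Qed.

Lemma climit_inv f l : l <> RtoC 0 -> climit F f l -> climit F (fun x => / f x)%C (/ l)%C.
Proof.
intros Hl Hf eps He. assert (Pl : 0 < Cmod l) by now apply Cmod_gt_0.
assert (He2 : 0 < eps * (Cmod l * (Cmod l / 2))) by (apply Rmult_lt_0_compat; nra).
generalize (filter_and _ _ (climit_nonzero _ _ Hl Hf) (Hf _ He2)). apply filter_imp. intros x [A B].
assert (N : f x <> RtoC 0) by (apply Cmod_gt_0; lra).
replace (/ f x - / l)%C with (- ((f x - l) / (l * f x)))%C by (field; auto).
rewrite Cmod_opp, Cmod_div by now apply Cmult_neq_0. rewrite Cmod_mult.
apply Rmult_lt_reg_r with (Cmod l * Cmod (f x)); [nra |].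
replace (Cmod (f x - l) / (Cmod l * Cmod (f x)) * (Cmod l * Cmod (f x))) with (Cmod (f x - l)) by (field; lra).
eapply Rlt_le_trans; [exact B |]. apply Rmult_le_compat_l; nra.
Qed.

Lemma climit_re f l : climit F f l -> filterlim (fun x => Re (f x)) F (locally (Re l)).
Proof.
intros Hf P [e He]. unfold filtermap. generalize (Hf e (cond_pos e)). apply filter_imp; intros x A.
apply He. eapply Rle_lt_trans; [| exact A].
change (Rabs (Re (f x) - Re l) <= Cmod (f x - l)).
eapply Rle_trans; [| apply re_le_Cmod]. right; reflexivity.
Qed.

Lemma climit_im f l : climit F f l -> filterlim (fun x => Im (f x)) F (locally (Im l)).
Proof.
intros Hf P [e He]. unfold filtermap. generalize (Hf e (cond_pos e)). apply filter_imp; intros x A.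
apply He. eapply Rle_lt_trans; [| exact A].
change (Rabs (Im (f x) - Im l) <= Cmod (f x - l)).
eapply Rle_trans; [| apply im_le_Cmod]. right; reflexivity.
Qed.

End ClimitAlgebra.

Lemma climit_unique {T} (F : (T -> Prop) -> Prop) {FF : ProperFilter F} f l m :
  climit F f l -> climit F f m -> l = m.
Proof.
intros Hl Hm. apply NNPP; intros N.
assert (P : 0 < Cmod (l - m)).
{ apply Cmod_gt_0. intros E. apply N.
  replace l with ((l - m) + m)%C by ring. rewrite E; ring. }
assert (He2 : 0 < Cmod (l - m) / 2) by lra.
destruct (filter_ex _ (filter_and _ _ (Hl _ He2) (Hm _ He2))) as [x [A B]].
assert (D := Cmod_triangle (f x - m) (- (f x - l))%C).
replace (f x - m + - (f x - l))%C with (l - m)%C in D by ring. rewrite Cmod_opp in D. lra.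
Qed.

Lemma locally_Cmod (z : C) (P : C -> Prop) :
  @locally C_UniformSpace z P <-> exists d, 0 < d /\ forall w, Cmod (w - z) < d -> P w.
Proof.
split.
- intros H. apply locally_C in H. destruct H as [d Hd]. exists d; split; [apply cond_pos | exact Hd].
- intros [d [Hd H]]. apply locally_C. exists (mkposreal d Hd); exact H.
Qed.

Lemma climit_id (z : C) : climit (@locally C_UniformSpace z) (fun w => w) z.
Proof. intros eps He. apply locally_Cmod. now exists eps. Qed.

(** The derivative as a limit of difference quotients: sums, products and inverses then
    reduce to ring identities between quotients. *)
Definition cderiv (f : C -> C) (z l : C) : Prop :=
  climit (@locally' C_UniformSpace z) (fun w => (f w - f z) / (w - z))%C l.

Lemma cderiv_eps f z l : cderiv f z l <-> forall eps, 0 < eps -> exists d, 0 < d /\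
  forall w, Cmod (w - z) < d -> Cmod (f w - f z - l * (w - z)) <= eps * Cmod (w - z).
Proof.
split.
- intros H eps He. destruct (proj1 (locally_Cmod _ _) (H eps He)) as [d [Hd B]].
  exists d; split; [exact Hd |]. intros w Hw.
  destruct (classic (w = z)) as [-> | N].
  { replace (f z - f z - l * (z - z))%C with (RtoC 0) by ring.
    replace (z - z)%C with (RtoC 0) by ring. rewrite Cmod_0. lra. }
  assert (N' := Cminus_neq_0 _ _ N).
  replace (f w - f z - l * (w - z))%C with (((f w - f z) / (w - z) - l) * (w - z))%C by (field; exact N').
  rewrite Cmod_mult. apply Rmult_le_compat_r; [apply Cmod_ge_0 |]. left; now apply B.
- intros H eps He. destruct (H (eps / 2)) as [d [Hd B]]; [lra |].
  apply locally_Cmod. exists d; split; [exact Hd |]. intros w Hw N.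
  assert (N' := Cminus_neq_0 _ _ N).
  assert (P : 0 < Cmod (w - z)) by now apply Cmod_gt_0.
  replace ((f w - f z) / (w - z) - l)%C with ((f w - f z - l * (w - z)) / (w - z))%C by (field; exact N').
  rewrite Cmod_div by exact N'. apply Rmult_lt_reg_r with (Cmod (w - z)); [exact P |].
  replace (Cmod (f w - f z - l * (w - z)) / Cmod (w - z) * Cmod (w - z)) with
    (Cmod (f w - f z - l * (w - z))) by (field; lra).
  specialize (B w Hw). nra.
Qed.

Lemma cderiv_is_derive f z l :
  @is_derive C_AbsRing C_NormedModule f z l <-> cderiv f z l.
Proof.
rewrite cderiv_eps. split.
- intros [_ H] eps He.
  destruct (H z (fun P HP => HP) (mkposreal eps He)) as [d Hd].
  exists d; split; [apply cond_pos |]. intros w Hw. rewrite (Cmult_comm l).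
  exact (Hd w Hw).
- intros H. split.
  { apply (@is_linear_scal_l C_AbsRing C_NormedModule). }
  intros x Hx. apply (@is_filter_lim_locally_unique C_AbsRing (AbsRing_NormedModule C_AbsRing)) in Hx.
  subst x. intros eps. destruct (H eps (cond_pos eps)) as [d [Hd B]].
  exists (mkposreal d Hd). intros w Hw. specialize (B w Hw). rewrite (Cmult_comm l) in B. exact B.
Qed.

Lemma cderiv_continuous f z l : cderiv f z l -> climit (locally z) f (f z).
Proof.
rewrite cderiv_eps. intros H eps He.
destruct (H 1 Rlt_0_1) as [d [Hd B]]. apply locally_Cmod.
assert (Pl := Cmod_ge_0 l).
assert (He' : 0 < eps / (Cmod l + 1)) by (apply Rdiv_lt_0_compat; lra).
exists (Rmin d (eps / (Cmod l + 1))). split; [now apply Rmin_glb_lt |].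
intros w Hw.
assert (W1 : Cmod (w - z) < d) by (eapply Rlt_le_trans; [exact Hw | apply Rmin_l]).
assert (W2 : Cmod (w - z) < eps / (Cmod l + 1)) by (eapply Rlt_le_trans; [exact Hw | apply Rmin_r]).
replace (f w - f z)%C with ((f w - f z - l * (w - z)) + l * (w - z))%C by ring.
eapply Rle_lt_trans; [apply Cmod_triangle |]. rewrite Cmod_mult.
specialize (B w W1).
apply Rle_lt_trans with ((Cmod l + 1) * Cmod (w - z)); [lra |].
apply Rlt_le_trans with ((Cmod l + 1) * (eps / (Cmod l + 1))).
- apply Rmult_lt_compat_l; lra.
- right; field; lra.
Qed.

Lemma climit_punctured f z l : climit (@locally C_UniformSpace z) f l -> climit (locally' z) f l.
Proof.
intros H eps He. unfold locally', within. generalize (H eps He).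
apply filter_imp. auto.
Qed.

Lemma cderiv_ext_loc f g z l : locally z (fun w => f w = g w) -> cderiv f z l -> cderiv g z l.
Proof.
intros E. apply climit_ext_loc.
assert (Ez := locally_singleton _ _ E). cbv beta in Ez.
unfold locally', within. generalize E. apply filter_imp. intros w Ew _. now rewrite Ew, Ez.
Qed.

Lemma cderiv_const c z : cderiv (fun _ => c) z 0.
Proof.
apply climit_ext with (fun _ => RtoC 0); [intros w | apply climit_const].
unfold Cdiv; ring.
Qed.

Lemma cderiv_id z : cderiv (fun w => w) z 1.
Proof.
apply climit_ext_loc with (fun _ => RtoC 1); [| apply climit_const].
unfold locally', within. apply filter_forall. intros w N. field.
now apply Cminus_neq_0.
Qed.

Lemma cderiv_plus f g z l m : cderiv f z l -> cderiv g z m ->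
  cderiv (fun w => f w + g w)%C z (l + m)%C.
Proof.
intros Hf Hg. eapply climit_ext; [| apply (climit_plus _ _ _ _ Hf Hg)].
intros w. unfold Cdiv; simpl; ring.
Qed.

Lemma cderiv_mult f g z l m : cderiv f z l -> cderiv g z m ->
  cderiv (fun w => f w * g w)%C z (l * g z + f z * m)%C.
Proof.
intros Hf Hg.
assert (Cg := climit_punctured _ _ _ (cderiv_continuous _ _ _ Hg)).
eapply climit_ext; [| apply (climit_plus _ _ _ _ (climit_mult _ _ _ _ Hf Cg) (climit_mult _ _ _ _ (climit_const (f z)) Hg))].
intros w. unfold Cdiv; simpl; ring.
Qed.

Lemma cderiv_opp f z l : cderiv f z l -> cderiv (fun w => - f w)%C z (- l)%C.
Proof.
intros Hf. eapply climit_ext; [| apply (climit_opp _ _ Hf)].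
intros w. unfold Cdiv; simpl; ring.
Qed.

Lemma cderiv_inv f z l : f z <> RtoC 0 -> cderiv f z l ->
  cderiv (fun w => / f w)%C z (- (l * / (f z * f z)))%C.
Proof.
intros N Hf.
assert (Cf := climit_punctured _ _ _ (cderiv_continuous _ _ _ Hf)).
eapply climit_ext_loc;
  [| apply (climit_opp _ _ (climit_mult _ _ _ _ Hf (climit_inv _ _ (Cmult_neq_0 _ _ N N)
       (climit_mult _ _ _ _ Cf (climit_const (f z))))))].
generalize (climit_nonzero _ _ N Cf). apply filter_imp. intros w Hw. simpl.
assert (Nw : f w <> RtoC 0) by (apply Cmod_gt_0; assert (P := Cmod_ge_0 (f z)); lra).
unfold Cdiv. set (i := (/ (w - z))%C). field. auto.
Qed.

(** * Integrals over concentric circles *)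

Lemma Cmod_le_2Rmax (w z : C) :
  Cmod (w - z) <= 2 * Rmax (Rabs (Re w - Re z)) (Rabs (Im w - Im z)).
Proof.
eapply Rle_trans; [apply Cmod_2Rmax |].
change (fst (w - z)%C) with (Re w - Re z). change (snd (w - z)%C) with (Im w - Im z).
apply Rmult_le_compat_r.
- eapply Rle_trans; [apply Rabs_pos | apply Rmax_l].
- apply Rle_trans with (sqrt (2 * 2)); [apply sqrt_le_1; lra | rewrite sqrt_square; lra].
Qed.

Lemma Cmod_lt_Rabs (w z : C) d :
  Rabs (Re w - Re z) < d / 2 -> Rabs (Im w - Im z) < d / 2 -> Cmod (w - z) < d.
Proof.
intros A B. eapply Rle_lt_trans; [apply Cmod_le_2Rmax |].
assert (Rmax (Rabs (Re w - Re z)) (Rabs (Im w - Im z)) < d / 2) by now apply Rmax_lub_lt.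
lra.
Qed.

(** The Cauchy-Riemann equations, together with differentiability in two real
    variables. *)
Lemma cderiv_CR f x y l : cderiv f (x, y) l ->
  differentiable_pt_lim (fun u v => Re (f (u, v))) x y (Re l) (- Im l) /\
  differentiable_pt_lim (fun u v => Im (f (u, v))) x y (Im l) (Re l).
Proof.
rewrite cderiv_eps. intros H.
assert (K : forall eps : posreal, locally_2d (fun u v =>
  Cmod (f (u, v) - f (x, y) - l * ((u, v) - (x, y))) <= eps * Rmax (Rabs (u - x)) (Rabs (v - y))) x y).
{ intros eps. destruct (H (eps / 2)) as [d [Hd B]]; [assert (P := cond_pos eps); lra |].
  assert (Hd2 : 0 < d / 2) by lra. exists (mkposreal _ Hd2). intros u v Hu Hv. simpl in Hu, Hv.
  eapply Rle_trans; [apply B; now apply Cmod_lt_Rabs |].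
  assert (M := Cmod_le_2Rmax (u, v) (x, y)). simpl in M.
  assert (P := cond_pos eps). nra. }
split; intros eps; destruct (K eps) as [d Hd]; exists d; intros u v Hu Hv;
  (eapply Rle_trans; [| exact (Hd u v Hu Hv)]).
- eapply Rle_trans; [| apply re_le_Cmod]. right; f_equal. simpl. unfold Re, Im. ring.
- eapply Rle_trans; [| apply im_le_Cmod]. right; f_equal. simpl. unfold Re, Im. ring.
Qed.

Lemma differentiable_exp_mult (h : R -> R) x y h' : is_derive h y h' ->
  differentiable_pt_lim (fun x y => exp x * h y) x y (exp x * h y) (exp x * h').
Proof.
intros Hh. apply filterdiff_differentiable_pt_lim.
eapply filterdiff_ext_lin.
- apply (filterdiff_mult_fct (K := R_AbsRing) (U := prod_NormedModule R_AbsRing R_NormedModule R_NormedModule)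
    (fun u : R * R => exp (fst u)) (fun u : R * R => h (snd u))).
  + exact Rmult_comm.
  + apply (filterdiff_comp' (K := R_AbsRing) (U := prod_NormedModule R_AbsRing R_NormedModule R_NormedModule)
      (V := R_NormedModule) (W := R_NormedModule) fst exp (x, y)).
    * apply filterdiff_linear, is_linear_fst.
    * apply (is_derive_exp x).
  + apply (filterdiff_comp' (K := R_AbsRing) (U := prod_NormedModule R_AbsRing R_NormedModule R_NormedModule)
      (V := R_NormedModule) (W := R_NormedModule) snd h (x, y)).
    * apply filterdiff_linear, is_linear_snd.
    * exact Hh.
- intros [u v]; simpl. unfold scal, plus, mult; simpl. unfold mult; simpl. ring.
Qed.

Definition polar (r t : R) : C := (r * cos t, r * sin t).

Lemma Cmod_polar r t : 0 <= r -> Cmod (polar r t) = r.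
Proof.
intros Hr. unfold Cmod, polar; simpl fst; simpl snd.
replace ((r * cos t) ^ 2 + (r * sin t) ^ 2) with (r * r * (Rsqr (sin t) + Rsqr (cos t)))
  by (unfold Rsqr; ring).
rewrite sin2_cos2, Rmult_1_r. now apply sqrt_square.
Qed.

(** In the coordinates [z = e^x (cos y, sin y)] the Cauchy-Riemann equations say that
    [Im f dx + Re f dy], the imaginary part of [f dz / z], is closed.  On the rectangle
    [ln r, ln r'] times [0, 2 pi] the two horizontal sides cancel by periodicity and
    the vertical ones are the two circle integrals. *)
Lemma circle_integral_const f r1 r2 :
  0 <= r1 -> (forall z, r1 < Cmod z < r2 -> exists l, cderiv f z l) ->
  forall r r', r1 < r -> r <= r' -> r' < r2 ->
  RInt (fun t => Re (f (polar r t))) 0 (2 * PI) = RInt (fun t => Re (f (polar r' t))) 0 (2 * PI).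
Proof.
intros Hr1 Hf r r' Hr Hrr' Hr'.
assert (HPI := PI_RGT_0).
assert (Hdiff : forall x y, ln r <= x <= ln r' -> exists Px D Qy,
  differentiable_pt_lim (fun x y => Im (f (exp x * cos y, exp x * sin y))) x y Px D /\
  differentiable_pt_lim (fun x y => Re (f (exp x * cos y, exp x * sin y))) x y D Qy).
{ intros x y Hx.
  destruct (Hf (exp x * cos y, exp x * sin y)) as [l Hl].
  { change (exp x * cos y, exp x * sin y) with (polar (exp x) y).
    rewrite Cmod_polar by (left; apply exp_pos).
    assert (A : exp (ln r) <= exp x) by (destruct Hx as [[Hx | <-] _]; [left; now apply exp_increasing | lra]).
    assert (B : exp x <= exp (ln r')) by (destruct Hx as [_ [Hx | ->]]; [left; now apply exp_increasing | lra]).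
    rewrite exp_ln in A, B by lra. lra. }
  destruct (cderiv_CR _ _ _ _ Hl) as [HR HI].
  assert (Hcos := differentiable_exp_mult cos x y _ (is_derive_cos y)).
  assert (Hsin := differentiable_exp_mult sin x y _ (is_derive_sin y)).
  eexists _, _, _. split.
  - exact (differentiable_pt_lim_comp _ _ _ _ _ _ _ _ _ _ _ HI Hcos Hsin).
  - assert (K := differentiable_pt_lim_comp _ _ _ _ _ _ _ _ _ _ _ HR Hcos Hsin).
    replace (Im l * (exp x * - sin y) + Re l * (exp x * cos y)) with
      (Re l * (exp x * cos y) + - Im l * (exp x * sin y)) by ring.
    exact K. }
assert (Hln : ln r <= ln r').
{ destruct Hrr' as [H | ->]; [left; apply ln_increasing; lra | lra]. }
assert (G := goursat_green _ _ (ln r) (ln r') 0 (2 * PI) Hln ltac:(lra) (fun x y Hx _ => Hdiff x y Hx)).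
unfold rect_integral in G.
rewrite (RInt_ext _ (fun _ => 0)) in G.
2:{ intros x _. rewrite cos_0, sin_0, cos_2PI, sin_2PI. apply Rminus_diag_eq. reflexivity. }
rewrite RInt_const in G.
assert (Ex : forall s, 0 < s -> ln r <= ln s <= ln r' ->
  ex_RInt (fun y => Re (f (exp (ln s) * cos y, exp (ln s) * sin y))) 0 (2 * PI)).
{ intros s Hs Hls. apply (@ex_RInt_continuous R_CompleteNormedModule). intros y _.
  apply (continuity_2d_pt_slice_y (fun x y => Re (f (exp x * cos y, exp x * sin y)))).
  destruct (Hdiff (ln s) y Hls) as (Px & D & Qy & _ & HQ).
  apply differentiable_continuity_pt. now exists D, Qy. }
rewrite (RInt_minus (V := R_CompleteNormedModule) (fun y => Re (f (exp (ln r') * cos y, exp (ln r') * sin y)))) in G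
  by (apply Ex; lra).
rewrite !exp_ln in G by lra.
unfold scal, minus, plus, opp in G; simpl in G; unfold mult in G; simpl in G.
unfold polar. lra.
Qed.

Definition continuous_on_closed_disc (f : C -> C) : Prop :=
  forall z, closed_disc z -> climit (within closed_disc (@locally C_UniformSpace z)) f (f z).

Lemma within_closed_disc (z : C) (P : C -> Prop) :
  within closed_disc (@locally C_UniformSpace z) P <->
  exists d, 0 < d /\ forall w, closed_disc w -> Cmod (w - z) < d -> P w.
Proof.
unfold within. rewrite locally_Cmod. split; intros [d [Hd H]]; exists d; split; auto.
Qed.

(** Composing the radius with the retraction of the line onto [0, 1] extends a function
    on the closed disc to all polar coordinates, so that uniform continuity on a
    rectangle applies. *)
Definition clamp (r : R) : R := Rmax 0 (Rmin 1 r).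

Lemma clamp_bounds r : 0 <= clamp r <= 1.
Proof.
unfold clamp. split; [apply Rmax_l |]. apply Rmax_lub; [lra | apply Rmin_l].
Qed.

Lemma clamp_id r : 0 <= r <= 1 -> clamp r = r.
Proof. intros H. unfold clamp. rewrite Rmin_right, Rmax_right; lra. Qed.

Lemma clamp_contract r s : Rabs (clamp r - clamp s) <= Rabs (r - s).
Proof.
unfold clamp, Rmax, Rmin.
repeat destruct Rle_dec; unfold Rabs; repeat destruct Rcase_abs; lra.
Qed.

Lemma continuity_2d_polar f r t : continuous_on_closed_disc f ->
  continuity_2d_pt (fun r t => Re (f (polar (clamp r) t))) r t.
Proof.
intros Hf eps.
assert (Hpol : forall s u, closed_disc (polar (clamp s) u)).
{ intros s u. unfold closed_disc. rewrite Cmod_polar; apply clamp_bounds. }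
destruct (proj1 (within_closed_disc _ _) (Hf _ (Hpol r t) eps (cond_pos eps))) as [d [Hd B]].
assert (Hcl : continuity_pt clamp r).
{ intros e He. exists e; split; [exact He |]. intros s [_ Hs].
  eapply Rle_lt_trans; [apply clamp_contract | exact Hs]. }
assert (Hc : forall h, continuity h -> continuity_2d_pt (fun r t => clamp r * h t) r t).
{ intros h Hh. apply continuity_2d_pt_mult.
  - apply (continuity_1d_2d_pt_comp clamp (fun u _ => u)); [exact Hcl | apply continuity_2d_pt_id1].
  - apply (continuity_1d_2d_pt_comp h (fun _ v => v)); [apply Hh | apply continuity_2d_pt_id2]. }
assert (Hd2 : 0 < d / 2) by lra.
generalize (locally_2d_and _ _ _ _ (Hc cos continuity_cos (mkposreal _ Hd2)) (Hc sin continuity_sin (mkposreal _ Hd2))).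
apply locally_2d_impl, locally_2d_forall. intros s u [A1 A2].
eapply Rle_lt_trans; [| apply (B (polar (clamp s) u) (Hpol s u))].
- eapply Rle_trans; [| apply re_le_Cmod]. right; reflexivity.
- apply Cmod_lt_Rabs; assumption.
Qed.

(** * The mean value property *)

(** The integral over the circle of radius [r] is continuous in [r] on [0, 1] and
    constant on each side of [rho]; comparing the radii [0], [rho] and [1] gives the
    claim.  The exceptional circle leaves room for one point of the disc at which
    differentiability is not known. *)
Lemma mean_value_re f rho :
  continuous_on_closed_disc f -> 0 <= rho < 1 ->
  (forall z, Cmod z < 1 -> z <> RtoC 0 -> Cmod z <> rho -> exists l, cderiv f z l) ->
  RInt (fun t => Re (f (polar 1 t))) 0 (2 * PI) = 2 * PI * Re (f 0).
Proof.
intros Hf Hrho Hd. assert (HPI := PI_RGT_0).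
set (g := fun r t => Re (f (polar (clamp r) t))).
assert (Hg : forall r t, continuity_2d_pt g r t) by (intros; now apply continuity_2d_polar).
set (I := fun r => RInt (g r) 0 (2 * PI)).
assert (Ex : forall r, ex_RInt (g r) 0 (2 * PI)).
{ intros r. apply (@ex_RInt_continuous R_CompleteNormedModule). intros t _.
  apply continuity_2d_pt_slice_y, Hg. }
assert (HI : forall eps, 0 < eps -> exists d, 0 < d /\ forall r s, 0 <= r <= 1 -> 0 <= s <= 1 ->
  Rabs (s - r) < d -> Rabs (I s - I r) <= eps).
{ intros eps He. assert (He' : 0 < eps / (2 * PI)) by (apply Rdiv_lt_0_compat; lra).
  destruct (uniform_continuity_2d g 0 1 0 (2 * PI) (fun r t _ _ => Hg r t) (mkposreal _ He')) as [d B].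
  exists d; split; [apply cond_pos |]. intros r s Hr Hs Hrs.
  unfold I. change (Rabs (minus (RInt (g s) 0 (2 * PI)) (RInt (g r) 0 (2 * PI))) <= eps).
  rewrite <- (RInt_minus (V := R_CompleteNormedModule)) by apply Ex.
  replace eps with ((2 * PI - 0) * (eps / (2 * PI))) by (field; lra).
  apply abs_RInt_le_const; [lra | apply (ex_RInt_minus (V := R_NormedModule)); apply Ex |].
  intros t Ht. left. apply B; try lra.
  rewrite Rminus_diag, Rabs_R0; apply cond_pos. }
assert (Hann : forall a b, 0 <= a -> a <= b -> b <= 1 ->
  (forall z, a < Cmod z < b -> exists l, cderiv f z l) -> I a = I b).
{ intros a b Ha Hab Hb Hz. destruct Hab as [Hab | <-]; [| reflexivity].
  apply Rminus_diag_uniq, Rabs_eq_0, Rle_antisym; [| apply Rabs_pos].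
  apply le_epsilon. intros eps He. rewrite Rplus_0_l.
  destruct (HI (eps / 2)) as [d [Hd0 B]]; [lra |].
  set (e := Rmin (d / 2) ((b - a) / 3)).
  assert (E0 : 0 < e) by (apply Rmin_glb_lt; lra).
  assert (E1 : e <= d / 2) by apply Rmin_l. assert (E2 : e <= (b - a) / 3) by apply Rmin_r.
  assert (EQ : I (a + e) = I (b - e)).
  { unfold I, g. rewrite !clamp_id by lra.
    apply (circle_integral_const f a b); try lra. exact Hz. }
  assert (A1 := B (a + e) a ltac:(lra) ltac:(lra)). assert (A2 := B b (b - e) ltac:(lra) ltac:(lra)).
  replace (a - (a + e)) with (- e) in A1 by ring. replace (b - e - b) with (- e) in A2 by ring.
  rewrite Rabs_Ropp, Rabs_pos_eq in A1, A2 by lra.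
  replace (I a - I b) with ((I a - I (a + e)) + (I (b - e) - I b)) by (rewrite EQ; ring).
  eapply Rle_trans; [apply Rabs_triang |]. specialize (A1 ltac:(lra)). specialize (A2 ltac:(lra)). lra. }
assert (nz : forall z a, 0 <= a -> a < Cmod z -> z <> RtoC 0).
{ intros z a Ha Hz ->. rewrite Cmod_0 in Hz. lra. }
assert (E : I 0 = I 1).
{ transitivity (I rho); apply Hann; try lra; intros z Hz; apply Hd; try lra; eapply nz; try apply Hz; lra. }
transitivity (I 1); [unfold I, g; rewrite clamp_id by lra; reflexivity |].
rewrite <- E. unfold I, g. rewrite clamp_id by lra.
rewrite (RInt_ext _ (fun _ => Re (f 0))).
- rewrite RInt_const. unfold scal; simpl; unfold mult; simpl. ring.
- intros t _. unfold polar. rewrite !Rmult_0_l. reflexivity.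
Qed.

Definition circle_mean (h : R -> C) : C :=
  (RInt (fun t => Re (h t)) 0 (2 * PI) / (2 * PI), RInt (fun t => Im (h t)) 0 (2 * PI) / (2 * PI)).

Definition Ccontinuous (h : R -> C) : Prop := forall t : R, climit (locally t) h (h t).

Lemma ex_RInt_Re h a b : Ccontinuous h -> ex_RInt (fun t => Re (h t)) a b.
Proof.
intros Hh. apply (@ex_RInt_continuous R_CompleteNormedModule). intros t _. apply climit_re, Hh.
Qed.

Lemma ex_RInt_Im h a b : Ccontinuous h -> ex_RInt (fun t => Im (h t)) a b.
Proof.
intros Hh. apply (@ex_RInt_continuous R_CompleteNormedModule). intros t _. apply climit_im, Hh.
Qed.

Lemma circle_mean_ext g h : (forall t, g t = h t) -> circle_mean g = circle_mean h.
Proof.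
intros E. unfold circle_mean.
f_equal; f_equal; apply RInt_ext; intros t _; now rewrite E.
Qed.

Lemma circle_mean_plus g h : Ccontinuous g -> Ccontinuous h ->
  circle_mean (fun t => g t + h t)%C = (circle_mean g + circle_mean h)%C.
Proof.
intros Hg Hh. assert (HPI := PI_RGT_0). unfold circle_mean, Cplus; simpl. f_equal.
- rewrite (RInt_plus (V := R_CompleteNormedModule) (fun t => Re (g t)) (fun t => Re (h t)))
    by now apply ex_RInt_Re.
  unfold plus; simpl. field. lra.
- rewrite (RInt_plus (V := R_CompleteNormedModule) (fun t => Im (g t)) (fun t => Im (h t)))
    by now apply ex_RInt_Im.
  unfold plus; simpl. field. lra.
Qed.

Lemma circle_mean_scal c h : Ccontinuous h ->
  circle_mean (fun t => c * h t)%C = (c * circle_mean h)%C.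
Proof.
intros Hh. assert (HPI := PI_RGT_0).
assert (ER := ex_RInt_Re h 0 (2 * PI) Hh). assert (EI := ex_RInt_Im h 0 (2 * PI) Hh).
assert (S : forall (k : R) (u : R -> R), ex_RInt u 0 (2 * PI) ->
  RInt (fun t => k * u t) 0 (2 * PI) = k * RInt u 0 (2 * PI)).
{ intros k u Hu. apply (RInt_scal (V := R_CompleteNormedModule)); exact Hu. }
assert (X : forall (k : R) (u : R -> R), ex_RInt u 0 (2 * PI) -> ex_RInt (fun t => k * u t) 0 (2 * PI)).
{ intros k u Hu. apply (ex_RInt_scal (V := R_NormedModule)); exact Hu. }
unfold circle_mean, Cmult; simpl. f_equal.
- rewrite (RInt_minus (V := R_CompleteNormedModule) (fun t => fst c * Re (h t)) (fun t => snd c * Im (h t)))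
    by now apply X.
  rewrite !S by assumption. unfold minus, plus, opp; simpl. field. lra.
- rewrite (RInt_plus (V := R_CompleteNormedModule) (fun t => fst c * Im (h t)) (fun t => snd c * Re (h t)))
    by now apply X.
  rewrite !S by assumption. unfold minus, plus, opp; simpl. field. lra.
Qed.

Lemma circle_mean_conj h : Ccontinuous h ->
  circle_mean (fun t => Cconj (h t)) = Cconj (circle_mean h).
Proof.
intros Hh. assert (HPI := PI_RGT_0). unfold circle_mean, Cconj; simpl. f_equal.
rewrite (RInt_opp (V := R_CompleteNormedModule) (fun t => Im (h t))) by now apply ex_RInt_Im.
unfold opp; simpl. field. lra.
Qed.

Definition unit_cis (t : R) : C := (cos t, sin t).

Lemma polar_1 t : polar 1 t = unit_cis t.
Proof. unfold polar, unit_cis. now rewrite !Rmult_1_l. Qed.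

Lemma Ccontinuous_unit_cis : Ccontinuous unit_cis.
Proof.
intros t eps He.
assert (He2 : 0 < eps / 2) by lra.
assert (A := continuous_cos t _ (locally_ball (cos t) (mkposreal _ He2))).
assert (B := continuous_sin t _ (locally_ball (sin t) (mkposreal _ He2))).
generalize (filter_and (fun s => ball (cos t) (mkposreal _ He2) (cos s))
  (fun s => ball (sin t) (mkposreal _ He2) (sin s)) A B). apply filter_imp. intros s [HA HB].
now apply Cmod_lt_Rabs.
Qed.

Lemma closed_disc_unit_cis t : closed_disc (unit_cis t).
Proof. unfold closed_disc. rewrite <- polar_1, Cmod_polar; lra. Qed.

Lemma continuous_on_closed_disc_circle f :
  continuous_on_closed_disc f -> Ccontinuous (fun t => f (unit_cis t)).
Proof.
intros Hf t eps He.
destruct (proj1 (within_closed_disc _ _) (Hf _ (closed_disc_unit_cis t) eps He)) as [d [Hd B]].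
generalize (Ccontinuous_unit_cis t d Hd). apply filter_imp. intros s Hs.
apply B; [apply closed_disc_unit_cis | exact Hs].
Qed.

(** The imaginary part is the real part of [- i f]. *)
Lemma mean_value f rho :
  continuous_on_closed_disc f -> 0 <= rho < 1 ->
  (forall z, Cmod z < 1 -> z <> RtoC 0 -> Cmod z <> rho -> exists l, cderiv f z l) ->
  circle_mean (fun t => f (unit_cis t)) = f 0.
Proof.
intros Hf Hrho Hd. assert (HPI := PI_RGT_0).
assert (HR := mean_value_re f rho Hf Hrho Hd).
assert (HI := mean_value_re (fun z => - Ci * f z)%C rho).
unfold circle_mean. rewrite (surjective_pairing (f 0)). f_equal.
- rewrite (RInt_ext _ (fun t => Re (f (polar 1 t)))) by (intros t _; now rewrite polar_1).
  rewrite HR. unfold Re. field. lra.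
- rewrite (RInt_ext _ (fun t => Re (- Ci * f (polar 1 t))%C)).
  + rewrite HI; [unfold Re; simpl; field; lra | | exact Hrho |].
    * intros z Hz. apply climit_mult; [apply climit_const | now apply Hf].
    * intros z H1 H2 H3. destruct (Hd z H1 H2 H3) as [l Hl]. eexists.
      apply (cderiv_mult (fun _ => - Ci)%C); [apply cderiv_const | exact Hl].
  + intros t _. rewrite polar_1. unfold Re, Im; simpl. ring.
Qed.

(** * The disc algebra and the Cauchy formula *)

Definition disc_algebra (f : C -> C) : Prop :=
  continuous_on_closed_disc f /\ forall z, Cmod z < 1 -> exists l, cderiv f z l.

Lemma climit_within (A : C -> Prop) z f l :
  climit (@locally C_UniformSpace z) f l -> climit (within A (@locally C_UniformSpace z)) f l.
Proof.
intros H eps He. unfold within. generalize (H eps He). apply filter_imp. auto.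
Qed.

Lemma climit_fill (f : C -> C) z : climit (@locally' C_UniformSpace z) f (f z) ->
  climit (@locally C_UniformSpace z) f (f z).
Proof.
intros H eps He. generalize (H eps He). unfold locally', within. apply filter_imp. intros w Hw.
destruct (classic (w = z)) as [-> | N]; [| now apply Hw].
replace (f z - f z)%C with (RtoC 0) by ring. now rewrite Cmod_0.
Qed.

Lemma locally_neq (w z : C) : w <> z -> @locally C_UniformSpace w (fun v => v <> z).
Proof.
intros N. apply locally_Cmod. exists (Cmod (z - w)). split.
- apply Cmod_gt_0, Cminus_neq_0. auto.
- intros v Hv ->. lra.
Qed.

Lemma disc_algebra_mean f : disc_algebra f -> circle_mean (fun t => f (unit_cis t)) = f 0.
Proof.
intros [Hc Hd]. apply (mean_value f 0); [exact Hc | lra |]. intros z Hz _ _. now apply Hd.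
Qed.

Lemma disc_algebra_mult f g : disc_algebra f -> disc_algebra g -> disc_algebra (fun z => f z * g z)%C.
Proof.
intros [Fc Fd] [Gc Gd]. split.
- intros z Hz. apply climit_mult; [now apply Fc | now apply Gc].
- intros z Hz. destruct (Fd z Hz) as [l Hl]. destruct (Gd z Hz) as [m Hm].
  eexists. apply cderiv_mult; eassumption.
Qed.

Lemma disc_algebra_id : disc_algebra (fun z => z).
Proof.
split; intros z Hz; [apply climit_within, climit_id | exists 1; apply cderiv_id].
Qed.

Lemma one_minus_neq_0 (a w : C) : Cmod a < 1 -> Cmod w <= 1 -> (1 - a * w)%C <> RtoC 0.
Proof.
intros Ha Hw E.
assert (H : Cmod (a * w) = 1).
{ replace (a * w)%C with (1 - (1 - a * w))%C by ring. rewrite E.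
  replace (1 - 0)%C with (RtoC 1) by ring. apply Cmod_1. }
rewrite Cmod_mult in H. assert (P := Cmod_ge_0 a). assert (Q := Cmod_ge_0 w). nra.
Qed.

Lemma disc_algebra_kernel a : Cmod a < 1 -> disc_algebra (fun w => / (1 - a * w))%C.
Proof.
intros Ha. split.
- intros z Hz. apply climit_inv; [now apply one_minus_neq_0 |].
  apply climit_minus; [apply climit_const |].
  apply climit_mult; [apply climit_const | apply climit_within, climit_id].
- intros z Hz. eexists. apply cderiv_inv; [apply one_minus_neq_0; lra |].
  apply (cderiv_plus (fun _ => RtoC 1) (fun w => - (a * w))%C); [apply cderiv_const |].
  apply cderiv_opp. apply (cderiv_mult (fun _ => a) (fun w => w)); [apply cderiv_const | apply cderiv_id].
Qed.

Lemma Cmult_conj_unit (s : C) : Cmod s = 1 -> (s * Cconj s)%C = 1.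
Proof.
intros H.
destruct s as [x y]. unfold Cmod in H; simpl fst in H; simpl snd in H.
assert (E : x ^ 2 + y ^ 2 = 1).
{ assert (P : 0 <= x ^ 2 + y ^ 2) by nra. rewrite <- (sqrt_sqrt _ P), H. ring. }
unfold Cconj, Cmult, RtoC; simpl. f_equal; [nra | ring].
Qed.

Lemma Cmod_unit_cis t : Cmod (unit_cis t) = 1.
Proof. rewrite <- polar_1. apply Cmod_polar; lra. Qed.

Lemma unit_cis_conj t : (unit_cis t * Cconj (unit_cis t))%C = 1.
Proof. apply Cmult_conj_unit, Cmod_unit_cis. Qed.

(** On the circle [1 / (1 - z conj u) = u / (u - z)], the Cauchy kernel for the angular
    measure [du / (i u)].  In this form its conjugate is holomorphic in [u], and its geometric
    expansion produces the Fourier coefficients. *)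
Definition cauchy_kernel (z : C) (t : R) : C := (/ (1 - z * Cconj (unit_cis t)))%C.

Lemma cauchy_kernel_conj z t : Cmod z < 1 -> cauchy_kernel z t = Cconj (/ (1 - Cconj z * unit_cis t))%C.
Proof.
intros Hz. unfold cauchy_kernel.
rewrite Cinv_conj by (apply one_minus_neq_0; [now rewrite Cmod_conj | rewrite Cmod_unit_cis; lra]).
rewrite Cminus_conj, Cmult_conj, Cconj_conj. f_equal. f_equal.
unfold Cconj, RtoC; simpl. f_equal; ring.
Qed.

Lemma Ccontinuous_mult g h : Ccontinuous g -> Ccontinuous h -> Ccontinuous (fun t => g t * h t)%C.
Proof. intros Hg Hh t. now apply climit_mult. Qed.

Lemma Ccontinuous_conj g : Ccontinuous g -> Ccontinuous (fun t => Cconj (g t)).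
Proof. intros Hg t. now apply climit_conj. Qed.

Lemma Ccontinuous_kernel z : Cmod z < 1 -> Ccontinuous (cauchy_kernel z).
Proof.
intros Hz t. eapply climit_ext; [intros s; symmetry; now apply cauchy_kernel_conj |].
rewrite cauchy_kernel_conj by exact Hz. apply climit_conj.
apply (continuous_on_closed_disc_circle (fun w => / (1 - Cconj z * w))%C).
apply disc_algebra_kernel. now rewrite Cmod_conj.
Qed.

(** The conjugate of the kernel is the holomorphic function [1 / (1 - conj z * w)],
    whose value at [0] is [1]. *)
Lemma cauchy_kernel_mean z : Cmod z < 1 -> circle_mean (cauchy_kernel z) = 1.
Proof.
intros Hz. rewrite (circle_mean_ext _ _ (fun t => cauchy_kernel_conj z t Hz)).
assert (K := disc_algebra_kernel (Cconj z)). rewrite Cmod_conj in K. specialize (K Hz).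
rewrite circle_mean_conj.
- rewrite (disc_algebra_mean _ K). replace (1 - Cconj z * 0)%C with (RtoC 1) by ring.
  unfold Cconj, Cinv, RtoC; simpl. f_equal; field.
- apply (continuous_on_closed_disc_circle _ (proj1 K)).
Qed.

(** The function [K w = (f w - f z) w / (w - z)], continued by [z f' z] at [w = z], is
    continuous and vanishes at [0].  Its differentiability is clear except at [z], which
    lies on a single circle, so that its mean over the unit circle is [0]. *)
Lemma cauchy_formula f z : disc_algebra f -> Cmod z < 1 ->
  f z = circle_mean (fun t => f (unit_cis t) * cauchy_kernel z t)%C.
Proof.
intros [Fc Fd] Hz.
destruct (Fd z Hz) as [l Hl].
set (K := fun w : C => if excluded_middle_informative (w = z) then (l * z)%C
                       else ((f w - f z) / (w - z) * w)%C).
assert (Kout : forall w, w <> z -> K w = ((f w - f z) / (w - z) * w)%C).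
{ intros w N. unfold K. now destruct excluded_middle_informative. }
assert (Kz : K z = (l * z)%C) by (unfold K; now destruct excluded_middle_informative).
assert (Kc : continuous_on_closed_disc K).
{ intros w Hw. destruct (classic (w = z)) as [-> | N].
  - apply climit_within, climit_fill. rewrite Kz.
    apply climit_ext_loc with (fun w => (f w - f z) / (w - z) * w)%C.
    + unfold locally', within. apply filter_forall. intros v Hv. now rewrite Kout.
    + apply climit_mult; [exact Hl | apply climit_punctured, climit_id].
  - rewrite Kout by exact N.
    apply climit_ext_loc with (fun w => (f w - f z) / (w - z) * w)%C.
    + unfold within. generalize (locally_neq _ _ N). apply filter_imp. intros v Hv _. now rewrite Kout.
    + apply climit_mult; [| apply climit_within, climit_id].
      apply climit_mult.
      * apply climit_minus; [now apply Fc | apply climit_const].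
      * apply climit_inv; [now apply Cminus_neq_0 |].
        apply climit_minus; [apply climit_within, climit_id | apply climit_const]. }
assert (Kd : forall w, Cmod w < 1 -> w <> z -> exists m, cderiv K w m).
{ intros w Hw N. destruct (Fd w Hw) as [m Hm]. eexists.
  apply cderiv_ext_loc with (fun w => (f w - f z) / (w - z) * w)%C.
  - generalize (locally_neq _ _ N). apply filter_imp. intros v Hv. now rewrite Kout.
  - apply (cderiv_mult (fun w => (f w - f z) / (w - z))%C (fun w => w)); [| apply cderiv_id].
    apply (cderiv_mult (fun w => f w - f z)%C (fun w => / (w - z))%C).
    + apply (cderiv_plus f (fun _ => - f z)%C); [exact Hm | apply cderiv_const].
    + apply cderiv_inv; [now apply Cminus_neq_0 |].
      apply (cderiv_plus (fun w => w) (fun _ => - z)%C); [apply cderiv_id | apply cderiv_const]. }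
assert (KM : circle_mean (fun t => K (unit_cis t)) = K 0).
{ apply (mean_value K (Cmod z)); [exact Kc | split; [apply Cmod_ge_0 | exact Hz] |].
  intros w H1 _ H2. apply Kd; [exact H1 |]. intros ->. now apply H2. }
assert (K0 : K 0 = 0).
{ destruct (classic (RtoC 0 = z)) as [<- | N]; [rewrite Kz | rewrite Kout by exact N]; ring. }
assert (Ku : forall t, K (unit_cis t) =
  (f (unit_cis t) * cauchy_kernel z t + - f z * cauchy_kernel z t)%C).
{ intros t.
  assert (N : unit_cis t <> z) by (intros <-; rewrite Cmod_unit_cis in Hz; lra).
  rewrite Kout by exact N. unfold cauchy_kernel.
  assert (H := unit_cis_conj t).
  assert (N1 := Cminus_neq_0 _ _ N).
  assert (N2 : (1 - z * Cconj (unit_cis t))%C <> RtoC 0).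
  { apply one_minus_neq_0; [exact Hz |]. rewrite Cmod_conj, Cmod_unit_cis; lra. }
  set (u := unit_cis t) in *. set (v := Cconj u) in *.
  assert (E : (/ (1 - z * v))%C = (u / (u - z))%C).
  { replace (u - z)%C with (u * (1 - z * v))%C
      by (transitivity (u * 1 - z * (u * v))%C; [ring | rewrite H; ring]).
    field. split; [exact N2 |]. intros U. rewrite U, Cmult_0_l in H.
    injection H as H. lra. }
  rewrite E. field. exact N1. }
assert (Ck := Ccontinuous_kernel z Hz).
rewrite (circle_mean_ext _ _ Ku), K0 in KM.
rewrite circle_mean_plus, (circle_mean_scal (- f z)), cauchy_kernel_mean in KM;
  [ | exact Hz | exact Ck | | ].
- apply (f_equal (fun x => x + f z)%C) in KM.
  transitivity (0 + f z)%C; [ring | rewrite <- KM; ring].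
- apply Ccontinuous_mult; [now apply continuous_on_closed_disc_circle | exact Ck].
- apply (Ccontinuous_mult (fun _ => - f z)%C); [intros t; apply climit_const | exact Ck].
Qed.

Fixpoint Csum (f : nat -> C) (n : nat) : C :=
  match n with O => RtoC 0 | S n => (Csum f n + f n)%C end.

Definition fourier_coef (f : C -> C) (j : nat) : C :=
  circle_mean (fun t => f (unit_cis t) * Cconj (unit_cis t) ^ j)%C.

(** The kernel [q] satisfies [q = 1 + z conj u * q]; unfold it [n] times. *)
Lemma cauchy_expansion f z n : disc_algebra f -> Cmod z < 1 ->
  f z = (Csum (fun j => z ^ j * fourier_coef f j) n +
    z ^ n * circle_mean (fun t => f (unit_cis t) * Cconj (unit_cis t) ^ n * cauchy_kernel z t))%C.
Proof.
intros Hf Hz.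
assert (Ck := Ccontinuous_kernel z Hz).
assert (Cu := Ccontinuous_conj _ Ccontinuous_unit_cis).
assert (Cf : forall j, Ccontinuous (fun t => f (unit_cis t) * Cconj (unit_cis t) ^ j)%C).
{ intros j. apply Ccontinuous_mult; [apply continuous_on_closed_disc_circle, Hf |].
  intros t. apply climit_pow, Cu. }
induction n as [|n IH].
- simpl. rewrite (cauchy_formula f z Hf Hz).
  rewrite (circle_mean_ext (fun t => f (unit_cis t) * 1 * cauchy_kernel z t)%C
    (fun t => f (unit_cis t) * cauchy_kernel z t)%C); [ring | intros t; ring].
- rewrite IH at 1. simpl Csum. rewrite <- Cplus_assoc. f_equal.
  rewrite (circle_mean_ext (fun t => f (unit_cis t) * Cconj (unit_cis t) ^ n * cauchy_kernel z t)%C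
    (fun t => f (unit_cis t) * Cconj (unit_cis t) ^ n +
       z * (f (unit_cis t) * Cconj (unit_cis t) ^ S n * cauchy_kernel z t))%C).
  + rewrite circle_mean_plus, circle_mean_scal; [unfold fourier_coef; simpl; ring | | exact (Cf n) |].
    * apply Ccontinuous_mult; [exact (Cf (S n)) | exact Ck].
    * apply (Ccontinuous_mult (fun _ => z)); [intros t; apply climit_const |].
      apply Ccontinuous_mult; [exact (Cf (S n)) | exact Ck].
  + intros t. unfold cauchy_kernel. simpl. field.
    apply one_minus_neq_0; [exact Hz |]. rewrite Cmod_conj, Cmod_unit_cis; lra.
Qed.

(** For [n = m + 1] the remainder of [cauchy_expansion] is, by the symmetry of [f], minus
    the conjugate of the mean of [f w * w / (1 - conj z * w)], a holomorphic function
    that vanishes at [0]. *)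
Lemma fourier_expansion_disc f m z : disc_algebra f ->
  (forall t, f (unit_cis t) = (- (Cconj (f (unit_cis t)) * unit_cis t ^ m))%C) ->
  Cmod z < 1 -> f z = Csum (fun j => z ^ j * fourier_coef f j)%C (S m).
Proof.
intros Hf Hsym Hz. rewrite (cauchy_expansion f z (S m) Hf Hz) at 1.
set (g := fun w => (f w * (w * / (1 - Cconj z * w)))%C).
assert (Hg : disc_algebra g).
{ apply disc_algebra_mult; [exact Hf |]. apply disc_algebra_mult; [apply disc_algebra_id |].
  apply disc_algebra_kernel. now rewrite Cmod_conj. }
rewrite (circle_mean_ext _ (fun t => - (1) * Cconj (g (unit_cis t)))%C).
- assert (Cg := continuous_on_closed_disc_circle _ (proj1 Hg)).
  rewrite circle_mean_scal, circle_mean_conj, (disc_algebra_mean g Hg);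
    [| exact Cg | now apply Ccontinuous_conj].
  replace (g 0) with (RtoC 0) by (unfold g; ring).
  replace (Cconj 0) with (RtoC 0) by (unfold Cconj, RtoC; simpl; f_equal; ring). ring.
- intros t. unfold g. rewrite cauchy_kernel_conj, !Cmult_conj by exact Hz. rewrite Hsym at 1.
  assert (H : (unit_cis t ^ m * Cconj (unit_cis t) ^ m)%C = 1).
  { rewrite <- Cpow_mult_l, unit_cis_conj. apply Cpow_1_l. }
  set (u := unit_cis t) in *. set (k := Cconj (/ (1 - Cconj z * u))%C). simpl.
  transitivity (- (Cconj (f u) * Cconj u * k) * (u ^ m * Cconj u ^ m))%C; [ring |].
  rewrite H. ring.
Qed.

Lemma climit_Csum {T} {F : (T -> Prop) -> Prop} {FF : Filter F} (f : T -> nat -> C) (l : nat -> C) n :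
  (forall j, climit F (fun x => f x j) (l j)) -> climit F (fun x => Csum (f x) n) (Csum l n).
Proof.
intros H. induction n as [|n IH]; simpl; [apply climit_const | now apply climit_plus].
Qed.

(** Radial limit of [fourier_expansion_disc]. *)
Lemma fourier_expansion_circle f m u : disc_algebra f ->
  (forall t, f (unit_cis t) = (- (Cconj (f (unit_cis t)) * unit_cis t ^ m))%C) ->
  Cmod u = 1 -> f u = Csum (fun j => u ^ j * fourier_coef f j)%C (S m).
Proof.
intros Hf Hsym Hu.
assert (Hcl : closed_disc u) by (unfold closed_disc; lra).
(* the radii that tend to [1] from below *)
set (F := within (fun r => r < 1) (within (fun r => 0 <= r) (locally 1))).
assert (FF : ProperFilter F).
{ unfold F. constructor; [| typeclasses eauto].
  intros P [e He]. exists (Rmax 0 (1 - e / 2)).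
  assert (Pe := cond_pos e).
  assert (M1 := Rmax_l 0 (1 - e / 2)). assert (M2 := Rmax_r 0 (1 - e / 2)).
  apply He; [| exact M1 | apply Rmax_lub_lt; lra].
  apply Rabs_lt_between'. split; [lra |]. apply Rle_lt_trans with 1; [apply Rmax_lub; lra | lra]. }
assert (Cr : climit F (fun r => r * u)%C u).
{ intros e He. unfold F, within. exists (mkposreal e He). intros r Hr _ _.
  replace (r * u - u)%C with (RtoC (r - 1) * u)%C by (rewrite RtoC_minus; ring).
  rewrite Cmod_mult, Cmod_R. rewrite Hu, Rmult_1_r. exact Hr. }
assert (Hin : F (fun r => Cmod (r * u) < 1 /\ closed_disc (r * u)%C)).
{ unfold F, within. apply filter_forall. intros r H0 H1.
  assert (E : Cmod (r * u) = r)
    by (rewrite Cmod_mult, Cmod_R; rewrite Hu, Rabs_pos_eq; lra).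
  unfold closed_disc. rewrite E. lra. }
apply (climit_unique F (fun r : R => f (r * u)%C)).
- intros e He.
  destruct (proj1 (within_closed_disc _ _) (proj1 Hf _ Hcl e He)) as [d [Hd B]].
  generalize (filter_and _ _ Hin (Cr d Hd)). apply filter_imp. intros r [[_ H1] H2]. now apply B.
- apply climit_ext_loc with (fun r : R => Csum (fun j => (r * u) ^ j * fourier_coef f j)%C (S m)).
  + generalize Hin. apply filter_imp. intros r [H1 _]. symmetry.
    now apply fourier_expansion_disc.
  + apply climit_Csum. intros j. apply climit_mult; [now apply climit_pow | apply climit_const].
Qed.

(** * The hypersurface, its tangent vectors and its co-normal forms along the disc *)

Ltac unfold_prod :=
  unfold Cminus, Cplus, Copp, Cmult, RtoC, minus, plus, opp, scal, zero; simpl;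
  unfold prod_plus, prod_opp, prod_scal, prod_zero; simpl;
  unfold plus, opp, scal, zero; simpl;
  unfold prod_plus, prod_opp, prod_scal, prod_zero; simpl;
  unfold plus, opp, scal, zero; simpl; unfold mult; simpl.

Lemma norm_C_R (z : C_R_NormedModule) : norm z = Cmod z.
Proof.
change (norm z) with (sqrt (Rabs (fst z) ^ 2 + Rabs (snd z) ^ 2)).
now rewrite !pow2_abs.
Qed.

Lemma norm_C2_snd (z : C2) : Cmod (snd z) <= norm z.
Proof.
rewrite <- norm_C_R. unfold norm at 2; simpl. unfold prod_norm.
assert (P := norm_ge_0 (snd z : C_R_NormedModule)).
eapply Rle_trans; [| apply sqrt_le_1_alt].
2:{ apply Rplus_le_compat_r with (r := norm (snd z : C_R_NormedModule) ^ 2).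
    apply (pow2_ge_0 (norm (fst z : C_R_NormedModule))). }
rewrite Rplus_0_l, sqrt_pow2; [right; reflexivity | exact P].
Qed.

(** Straight lines drawn in [M] suffice to detect the co-normal condition along the flat
    disc. *)
Lemma tangent_line (M : C2 -> Prop) (p v : C2) :
  locally 0 (fun t : R => M (plus p (scal t v))) -> tangent_space M p v.
Proof.
intros H. exists (fun t => plus p (scal t v)), (fun _ => v). split; [| split; [reflexivity |]].
- transitivity (plus p zero); [f_equal; apply (scal_zero_l v) | apply plus_zero_r].
- generalize H. apply filter_imp. intros t Ht. split; [exact Ht | split].
  + assert (K : is_derive (fun t => plus p (scal t v)) t (plus zero (scal one v))).
    { apply (is_derive_plus (K := R_AbsRing) (V := C2)); [apply is_derive_const |].
      apply (is_derive_scal_l (K := R_AbsRing) (V := C2) (fun t => t) t one v).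
      apply (is_derive_id (K := R_AbsRing)). }
    rewrite (plus_zero_l (G := C2)), scal_one in K. exact K.
  + apply continuous_const.
Qed.

(** Divide [Re (z1^k z2) = 0] along the curve by the real parameter [t] and let [t] tend
    to [0]: since [z2] vanishes at [t = 0], the limit is [Re (s^k v2)]. *)
Lemma tangent_Mk_flat k (s : C) (v : C2) : Cmod s = 1 ->
  tangent_space (Mk k) (s, RtoC 0) v -> Re (s ^ k * snd v)%C = 0.
Proof.
intros Hs (g & g' & Hg0 & Hg'0 & Hloc).
destruct (locally_singleton _ _ Hloc) as (_ & Hd & _). rewrite Hg'0 in Hd.
assert (Hd2 := Hd). destruct Hd2 as [_ Hdom]. specialize (Hdom 0 (fun P HP => HP)).
assert (Hc := ex_derive_continuous g 0 (ex_intro _ v Hd)).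
assert (L1 : climit (locally' (0 : R)) (fun t => fst (g t) : C) s).
{ intros e He.
  assert (He2 : 0 < e / 2) by lra.
  assert (A := Hc _ (locally_ball (g 0) (mkposreal _ He2))). unfold filtermap in A. rewrite Hg0 in A.
  unfold locally', within. generalize A. apply filter_imp. intros t [[B1 B2] _] _.
  apply Cmod_lt_Rabs; assumption. }
assert (L2 : climit (locally' (0 : R)) (fun t => snd (g t) / t)%C (snd v)).
{ intros e He.
  assert (He2 : 0 < e / 2) by lra.
  specialize (Hdom (mkposreal _ He2)). unfold locally', within. generalize Hdom.
  apply filter_imp. intros t Ht Nt. simpl in Ht. rewrite Hg0 in Ht.
  assert (Pt : 0 < Rabs t) by now apply Rabs_pos_lt.
  assert (N : RtoC t <> RtoC 0) by (intros E; apply Nt; now injection E).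
  replace (snd (g t) / t - snd v)%C with ((snd (g t) - t * snd v) / t)%C by (field; exact N).
  rewrite Cmod_div, Cmod_R by exact N.
  apply Rmult_lt_reg_r with (Rabs t); [exact Pt |].
  replace (Cmod (snd (g t) - t * snd v) / Rabs t * Rabs t) with (Cmod (snd (g t) - t * snd v)) by (field; lra).
  apply Rle_lt_trans with (e / 2 * Rabs t); [| nra].
  eapply Rle_trans; [| eapply Rle_trans; [exact Ht |]].
  - eapply Rle_trans; [| apply norm_C2_snd]. right; f_equal.
    destruct (g t) as [[x1 y1] [x2 y2]], v as [[v1 w1] [v2 w2]].
    unfold_prod. f_equal; ring.
  - right. f_equal. unfold norm, minus, plus, opp; simpl. unfold abs; simpl. f_equal; ring. }
assert (L := climit_re _ _ (climit_mult _ _ _ _ (climit_pow _ _ k L1) L2)).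
assert (FF : ProperFilter (locally' (0 : R))) by exact (Rbar_locally'_filter (Finite 0)).
apply (filterlim_locally_unique _ _ _ L).
apply filterlim_ext_loc with (fun _ : R => 0); [| apply filterlim_const].
unfold locally', within. generalize Hloc. apply filter_imp.
intros t [[HM _] _] Nt.
assert (N : RtoC t <> RtoC 0) by (intros E; apply Nt; now injection E).
replace (fst (g t) ^ k * (snd (g t) / t))%C with (RtoC (/ t) * (fst (g t) ^ k * snd (g t)))%C
  by (rewrite RtoC_inv by exact Nt; field; exact N).
assert (S : forall (r : R) (z : C), Re (RtoC r * z) = r * Re z) by (intros r z; unfold Re; simpl; ring).
rewrite S, HM. ring.
Qed.

(** The vectors [(v1, 0)] for all [v1], and the vector [(0, i conj s^k)], are tangent; the
    former force [a1 = 0], the latter forces [a2 conj s^k] to be imaginary. *)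
Lemma conormal_Mk_flat k (s a1 a2 : C) : Cmod s = 1 ->
  conormal (Mk k) (s, RtoC 0) (a1, a2) <-> a1 = RtoC 0 /\ exists c : R, a2 = (Ci * c * s ^ k)%C.
Proof.
intros Hs.
assert (Ns : s <> RtoC 0) by (intros ->; rewrite Cmod_0 in Hs; lra).
assert (Hsk : (s ^ k * Cconj s ^ k)%C = 1).
{ rewrite <- Cpow_mult_l, Cmult_conj_unit by exact Hs. apply Cpow_1_l. }
split.
- intros H.
  assert (T1 : forall v1 : C, tangent_space (Mk k) (s, RtoC 0) (v1, RtoC 0)).
  { intros v1. apply tangent_line.
    assert (Hd : 0 < / (Cmod v1 + 1)) by (apply Rinv_0_lt_compat; assert (P := Cmod_ge_0 v1); lra).
    exists (mkposreal _ Hd). intros t Ht. change (Rabs (t - 0) < / (Cmod v1 + 1)) in Ht.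
    rewrite Rminus_0_r in Ht.
    assert (E : plus ((s, RtoC 0) : C2) (scal t ((v1, RtoC 0) : C2)) = (s + t * v1, RtoC 0)%C).
    { destruct s, v1. unfold_prod. repeat (f_equal; try ring). }
    rewrite E. split; simpl.
    - ring.
    - intros Z. assert (B : s = (- (t * v1))%C).
      { transitivity ((s + t * v1) - t * v1)%C; [ring | rewrite Z; ring]. }
      apply (f_equal Cmod) in B. rewrite Hs, Cmod_opp, Cmod_mult, Cmod_R in B.
      assert (P := Cmod_ge_0 v1). assert (Q := Rabs_pos t).
      assert (Rabs t * (Cmod v1 + 1) < 1).
      { apply Rlt_le_trans with (/ (Cmod v1 + 1) * (Cmod v1 + 1)); [apply Rmult_lt_compat_r; lra | right; field; lra]. }
      nra. }
  assert (A1 : a1 = RtoC 0).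
  { assert (E1 := H _ (T1 (RtoC 1))). assert (E2 := H _ (T1 Ci)).
    unfold form_eval in E1, E2. destruct a1 as [x y]. unfold Im in *; simpl in *.
    unfold RtoC. f_equal; lra. }
  split; [exact A1 |].
  assert (T2 : tangent_space (Mk k) (s, RtoC 0) (RtoC 0, Ci * Cconj s ^ k)%C).
  { apply tangent_line. apply filter_forall. intros t.
    assert (E : plus ((s, RtoC 0) : C2) (scal t ((RtoC 0, Ci * Cconj s ^ k)%C : C2)) = (s, RtoC t * (Ci * Cconj s ^ k))%C).
    { set (w := (Ci * Cconj s ^ k)%C).
      destruct s, w. unfold_prod. repeat (f_equal; try ring). }
    rewrite E. split; [| exact Ns].
    change (Re (s ^ k * (t * (Ci * Cconj s ^ k)))%C = 0).
    replace (s ^ k * (t * (Ci * Cconj s ^ k)))%C with (t * Ci * (s ^ k * Cconj s ^ k))%C by ring.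
    rewrite Hsk. unfold Re; simpl; ring. }
  assert (E := H _ T2). unfold form_eval in E; simpl fst in E; simpl snd in E.
  rewrite A1 in E.
  exists (Im (a2 * Cconj s ^ k)%C).
  transitivity (a2 * Cconj s ^ k * s ^ k)%C.
  { transitivity (a2 * (s ^ k * Cconj s ^ k))%C; [rewrite Hsk; ring | ring]. }
  f_equal.
  replace (0 * 0 + a2 * (Ci * Cconj s ^ k))%C with (Ci * (a2 * Cconj s ^ k))%C in E by ring.
  destruct (a2 * Cconj s ^ k)%C as [x y]. unfold Im, Ci in *; simpl in *.
  unfold Cmult, RtoC; simpl. f_equal; lra.
- intros [-> [c ->]] v Hv.
  assert (E := tangent_Mk_flat k s v Hs Hv).
  change (Im (0 * fst v + Ci * c * s ^ k * snd v)%C = 0).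
  replace (0 * fst v + Ci * c * s ^ k * snd v)%C with (Ci * c * (s ^ k * snd v))%C by ring.
  destruct (s ^ k * snd v)%C as [x y]. unfold Re, Im in *; simpl in *. rewrite E. ring.
Qed.

Lemma flat_disc_attached k delta : attached_disc delta (Mk k) flat_disc.
Proof.
assert (Hlin : is_linear (flat_disc : C_R_NormedModule -> C2)).
{ apply (is_linear_prod (K := R_AbsRing) (T := C_R_NormedModule) (U := C_R_NormedModule) (V := C_R_NormedModule)).
  - apply is_linear_id.
  - exact (is_linear_zero (K := R_AbsRing) (U := C_R_NormedModule) (V := C_R_NormedModule)). }
split; [split |].
- intros z _ P HP.
  apply (filter_le_within (F := locally z)).
  exact (filterdiff_continuous flat_disc z (ex_intro _ _ (filterdiff_linear _ Hlin)) P HP).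
- exists (fun _ v => flat_disc v). split.
  + intros z _. apply filterdiff_linear, Hlin.
  + intros v. exists 0. intros x y _ _ _.
    rewrite Rmult_0_l, minus_eq_zero. right. apply (norm_zero (V := C2)).
- split; [| split].
  + intros z _. exists (RtoC 1). apply (cderiv_is_derive (fun z => z)), cderiv_id.
  + intros z _. exists (RtoC 0). apply (cderiv_is_derive (fun z => RtoC 0)), cderiv_const.
  + intros s. split.
    * change (Re (cpt s ^ k * 0)%C = 0). replace (cpt s ^ k * 0)%C with (RtoC 0) by ring. reflexivity.
    * change (cpt s <> RtoC 0). intros E. assert (H := proj2_sig s). simpl in H. fold (cpt s) in H. rewrite E, Cmod_0 in H. lra.
Qed.

Lemma locally_fst_neq_0 (p : C2) : fst p <> RtoC 0 -> locally p (fun q : C2 => fst q <> RtoC 0).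
Proof.
intros N. destruct (locally_neq (fst p) 0 N) as [e He].
exists e. intros q [Hq _]. now apply He.
Qed.

Definition C1_fun (u : C2 -> R) (du : C2 -> C2 -> R) : Prop :=
  (forall q, filterdiff (V := R_NormedModule) u (locally q) (du q)) /\
  (forall q v, continuous (U := R_UniformSpace) (fun q' => du q' v) q).

Lemma C1_fun_continuous u du q : C1_fun u du -> continuous (U := R_UniformSpace) u q.
Proof. intros [Hd _]. apply (filterdiff_continuous (V := R_NormedModule) u q). now exists (du q). Qed.

Lemma C1_fun_linear (l : C2 -> R) : is_linear (V := R_NormedModule) l -> C1_fun l (fun _ => l).
Proof.
intros Hl. split; intros q; [now apply filterdiff_linear | intros v; apply continuous_const].
Qed.

Lemma C1_fun_mult u v du dv : C1_fun u du -> C1_fun v dv ->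
  C1_fun (fun q => u q * v q) (fun q w => du q w * v q + u q * dv q w).
Proof.
intros Hu Hv. split.
- intros q. apply (filterdiff_mult_fct (K := R_AbsRing) (U := C2) u v); [exact Rmult_comm | apply Hu | apply Hv].
- intros q w.
  apply (continuous_plus (V := R_NormedModule) (fun q => du q w * v q) (fun q => u q * dv q w)).
  + apply (continuous_mult (K := R_AbsRing)); [apply Hu | eapply C1_fun_continuous, Hv].
  + apply (continuous_mult (K := R_AbsRing)); [eapply C1_fun_continuous, Hu | apply Hv].
Qed.

Lemma C1_fun_plus u v du dv : C1_fun u du -> C1_fun v dv ->
  C1_fun (fun q => u q + v q) (fun q w => du q w + dv q w).
Proof.
intros Hu Hv. split.
- intros q. apply (filterdiff_plus_fct (V := R_NormedModule) u v); [apply Hu | apply Hv].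
- intros q w. apply (continuous_plus (V := R_NormedModule)); [apply Hu | apply Hv].
Qed.

Lemma C1_fun_minus u v du dv : C1_fun u du -> C1_fun v dv ->
  C1_fun (fun q => u q - v q) (fun q w => du q w - dv q w).
Proof.
intros Hu Hv. split.
- intros q. apply (filterdiff_minus_fct (V := R_NormedModule) u v); [apply Hu | apply Hv].
- intros q w. apply (continuous_minus (V := R_NormedModule)); [apply Hu | apply Hv].
Qed.

Lemma is_linear_C2_coord (l : C_R_NormedModule -> R) : is_linear (V := R_NormedModule) l ->
  is_linear (V := R_NormedModule) (fun q : C2 => l (fst q)) /\
  is_linear (V := R_NormedModule) (fun q : C2 => l (snd q)).
Proof.
intros Hl. split.
- apply (is_linear_comp (U := C2) (V := C_R_NormedModule) (W := R_NormedModule) fst l); [apply is_linear_fst | exact Hl].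
- apply (is_linear_comp (U := C2) (V := C_R_NormedModule) (W := R_NormedModule) snd l); [apply is_linear_snd | exact Hl].
Qed.

(** The third clause says that [z1^n] does not depend on [z2]; it isolates the
    [z2]-derivative of the defining function. *)
Lemma C1_fun_pow n : exists du dv,
  C1_fun (fun q => Re (fst q ^ n)%C) du /\ C1_fun (fun q => Im (fst q ^ n)%C) dv /\
  forall q w, fst w = RtoC 0 -> du q w = 0 /\ dv q w = 0.
Proof.
assert (LR := C1_fun_linear _ (proj1 (is_linear_C2_coord Re (is_linear_fst (K := R_AbsRing) (U := R_NormedModule) (V := R_NormedModule))))).
assert (LI := C1_fun_linear _ (proj1 (is_linear_C2_coord Im (is_linear_snd (K := R_AbsRing) (U := R_NormedModule) (V := R_NormedModule))))).
assert (Hconst : forall c : R, C1_fun (fun _ => c) (fun _ _ => 0)).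
{ intros c. split; intros q; [| intros w; apply continuous_const].
  exact (filterdiff_const (K := R_AbsRing) (U := C2) (V := R_NormedModule) c). }
induction n as [|n (du & dv & Hu & Hv & H0)].
- exists (fun _ _ => 0), (fun _ _ => 0). split; [| split; [| intros; split; reflexivity]].
  + exact (Hconst 1).
  + exact (Hconst 0).
- eexists _, _. split; [| split].
  + apply (C1_fun_minus _ _ _ _ (C1_fun_mult _ _ _ _ LR Hu) (C1_fun_mult _ _ _ _ LI Hv)).
  + apply (C1_fun_plus _ _ _ _ (C1_fun_mult _ _ _ _ LR Hv) (C1_fun_mult _ _ _ _ LI Hu)).
  + intros q w Hw. destruct (H0 q w Hw) as [-> ->].
    destruct w as [w1 w2]. simpl in Hw. subst w1. simpl. split; ring.
Qed.

(** [Re (z1^k z2)] is a defining function near every point with [z1 <> 0]; its derivative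
    in the direction [(0, conj (z1^k))] is [|z1^k|^2]. *)
Lemma Mk_real_hypersurface k : real_hypersurface (Mk k).
Proof.
assert (LR := C1_fun_linear _ (proj2 (is_linear_C2_coord Re (is_linear_fst (K := R_AbsRing) (U := R_NormedModule) (V := R_NormedModule))))).
assert (LI := C1_fun_linear _ (proj2 (is_linear_C2_coord Im (is_linear_snd (K := R_AbsRing) (U := R_NormedModule) (V := R_NormedModule))))).
destruct (C1_fun_pow k) as (du & dv & Hu & Hv & H0).
assert (Hrho := C1_fun_minus _ _ _ _ (C1_fun_mult _ _ _ _ Hu LR) (C1_fun_mult _ _ _ _ Hv LI)).
intros p [_ Np].
eexists _, _. generalize (locally_fst_neq_0 p Np). intros Hloc.
split.
- generalize Hloc. apply filter_imp. intros q Nq. split; [| split].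
  2: exact (proj1 Hrho q).
  2: exact (proj2 Hrho q).
  split; [intros [H _]; exact H | intros H; split; [exact H | exact Nq]].
- exists (RtoC 0, Cconj (fst p ^ k)%C).
  destruct (H0 p (RtoC 0, Cconj (fst p ^ k)%C) eq_refl) as [-> ->].
  assert (N := Cpow_nz _ k Np). simpl. intros E. apply N.
  set (z := (fst p ^ k)%C) in *.
  change (0 * Re (snd p) + Re z * Re z - (0 * Im (snd p) + Im z * - Im z) = 0) in E.
  clearbody z. destruct z as [x y]. unfold Re, Im in E. simpl in E.
  assert (x * x + y * y = 0) by lra.
  unfold RtoC. f_equal; nra.
Qed.

(** * Sections that are regular and extend holomorphically *)

Lemma continuous_within_closed_disc F :
  continuous_within (U := C_R_NormedModule) (V := C_R_NormedModule) closed_disc F <->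
  continuous_on_closed_disc F.
Proof.
split.
- intros H z Hz e He. apply (H z Hz (fun y : C => Cmod (y - F z) < e)).
  apply (proj2 (locally_Cmod (F z) (fun y => Cmod (y - F z) < e))). now exists e.
- intros H z Hz P HP.
  destruct (proj1 (locally_Cmod _ _) HP) as [e [He B]].
  unfold filtermap, within. generalize (H z Hz e He). unfold within. apply filter_imp. intros w Hw Cw. apply B. exact (Hw Cw).
Qed.

Lemma extends_iff a : extends_holomorphically a <->
  exists F, disc_algebra F /\ forall s, F (cpt s) = a s.
Proof.
split.
- intros (F & Fc & Fd & FE). exists F. split; [split | exact FE].
  + now apply continuous_within_closed_disc.
  + intros z Hz. destruct (Fd z Hz) as [l Hl]. exists l. now apply cderiv_is_derive.
- intros (F & [Fc Fd] & FE). exists F. split; [| split]; [| | exact FE].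
  + now apply continuous_within_closed_disc.
  + intros z Hz. destruct (Fd z Hz) as [l Hl]. exists l. now apply cderiv_is_derive.
Qed.

Lemma disc_algebra_plus f g : disc_algebra f -> disc_algebra g -> disc_algebra (fun z => f z + g z)%C.
Proof.
intros [Fc Fd] [Gc Gd]. split.
- intros z Hz. apply climit_plus; [now apply Fc | now apply Gc].
- intros z Hz. destruct (Fd z Hz) as [l Hl]. destruct (Gd z Hz) as [m Hm].
  eexists. apply cderiv_plus; eassumption.
Qed.

Lemma disc_algebra_const c : disc_algebra (fun _ => c).
Proof. split; intros z Hz; [apply climit_const | exists 0; apply cderiv_const]. Qed.

Lemma disc_algebra_pow n : disc_algebra (fun z => z ^ n)%C.
Proof.
induction n as [|n IH]; [exact (disc_algebra_const (RtoC 1)) |].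
exact (disc_algebra_mult _ _ disc_algebra_id IH).
Qed.

(** The conditions on a section of the co-normal bundle other than being co-normal; they
    are preserved by real linear combinations. *)
Definition regular_section (delta : R) (a : circle -> C2) : Prop :=
  C1holder_circle delta a /\
  extends_holomorphically (fun s => fst (a s)) /\ extends_holomorphically (fun s => snd (a s)).

Lemma minus_plus_plus {G : AbelianGroup} (a b c d : G) :
  minus (plus a b) (plus c d) = plus (minus a c) (minus b d).
Proof.
unfold minus. rewrite opp_plus, <- !plus_assoc. f_equal.
rewrite !plus_assoc. f_equal. apply plus_comm.
Qed.

Lemma C1holder_circle_plus {V : NormedModule R_AbsRing} delta (a b : circle -> V) :
  C1holder_circle delta a -> C1holder_circle delta b ->
  C1holder_circle delta (fun s => plus (a s) (b s)).
Proof.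
intros (a' & Da & Ka & Ha) (b' & Db & Kb & Hb).
exists (fun t => plus (a' t) (b' t)). split.
- intros t. apply (is_derive_plus (K := R_AbsRing)); [apply Da | apply Db].
- exists (Ka + Kb). intros x y _ _ N.
  assert (A := Ha x y I I N). assert (B := Hb x y I I N).
  replace (minus (plus (a' x) (b' x)) (plus (a' y) (b' y))) with
    (plus (minus (a' x) (a' y)) (minus (b' x) (b' y))).
  + eapply Rle_trans; [apply norm_triangle | lra].
  + symmetry. exact (minus_plus_plus (G := NormedModule.AbelianGroup R_AbsRing V) _ _ _ _).
Qed.

Lemma C1holder_circle_scal {V : NormedModule R_AbsRing} delta (c : R) (a : circle -> V) :
  C1holder_circle delta a -> C1holder_circle delta (fun s => scal c (a s)).
Proof.
intros (a' & Da & Ka & Ha). exists (fun t => scal c (a' t)). split.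
- intros t. unfold is_derive. eapply filterdiff_ext_lin.
  + apply (filterdiff_scal_r_fct (K := R_AbsRing) (V := V) c _ _ Rmult_comm (Da t)).
  + intros y. simpl. rewrite !scal_assoc. f_equal. apply Rmult_comm.
- exists (Rabs c * Ka). intros x y _ _ N.
  assert (A := Ha x y I I N).
  rewrite <- (scal_minus_distr_l (V := V) c).
  eapply Rle_trans; [apply (norm_scal (V := V)) |].
  rewrite Rmult_assoc. apply Rmult_le_compat_l; [apply Rabs_pos | exact A].
Qed.

Lemma scal_C (c : R) (z : C) : scal c (z : C_R_NormedModule) = (c * z)%C.
Proof. destruct z as [x y]. unfold_prod. f_equal; ring. Qed.

Lemma extends_plus (f g : circle -> C) : extends_holomorphically f -> extends_holomorphically g ->
  extends_holomorphically (fun s => f s + g s)%C.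
Proof.
rewrite !extends_iff. intros (F & FD & FE) (G & GD & GE).
exists (fun z => F z + G z)%C. split; [now apply disc_algebra_plus |].
intros s. now rewrite FE, GE.
Qed.

Lemma extends_scal (c : R) (f : circle -> C) : extends_holomorphically f ->
  extends_holomorphically (fun s => scal c (f s : C_R_NormedModule)).
Proof.
rewrite !extends_iff. intros (F & FD & FE).
exists (fun z => c * F z)%C.
split; [apply disc_algebra_mult; [apply disc_algebra_const | exact FD] |].
intros s. now rewrite FE, scal_C.
Qed.

Lemma regular_section_plus delta a b : regular_section delta a -> regular_section delta b ->
  regular_section delta (fun s => plus (a s) (b s)).
Proof.
intros (A1 & A2 & A3) (B1 & B2 & B3). split; [now apply C1holder_circle_plus | split].
- exact (extends_plus _ _ A2 B2).
- exact (extends_plus _ _ A3 B3).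
Qed.

Lemma regular_section_scal delta c a : regular_section delta a ->
  regular_section delta (fun s => scal c (a s)).
Proof.
intros (A1 & A2 & A3). split; [now apply C1holder_circle_scal | split].
- exact (extends_scal c _ A2).
- exact (extends_scal c _ A3).
Qed.

Lemma lipschitz_of_derive f f' L : (forall t, is_derive f t (f' t)) -> (forall t, Rabs (f' t) <= L) ->
  forall x y, Rabs (f x - f y) <= L * Rabs (x - y).
Proof.
intros Hd HL x y.
destruct (MVT_abs f f' y x) as (c & E & _); [intros; apply is_derive_Reals, Hd |].
rewrite E. apply Rmult_le_compat_r; [apply Rabs_pos | apply HL].
Qed.

(** At distance at most [1] the Lipschitz bound wins, because [d <= d^delta]; beyond that
    the sup bound does, because [d^delta >= 1]. *)
Lemma holder_of_bounded_lipschitz f B L delta : 0 < delta < 1 -> 0 <= B -> 0 <= L ->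
  (forall t, Rabs (f t) <= B) -> (forall x y, Rabs (f x - f y) <= L * Rabs (x - y)) ->
  forall x y, x <> y -> Rabs (f x - f y) <= (L + 2 * B) * Rpower (Rabs (x - y)) delta.
Proof.
intros Hd HB HL Hb Hl x y N.
assert (P : 0 < Rabs (x - y)) by (apply Rabs_pos_lt; lra).
set (d := Rabs (x - y)) in *.
destruct (Rle_dec d 1) as [D | D].
- assert (E : d <= Rpower d delta).
  { rewrite <- (Rpower_1 d) at 1 by exact P. unfold Rpower.
    assert (ln d <= 0) by (rewrite <- ln_1; destruct D as [D | ->]; [left; now apply ln_increasing | lra]).
    assert (H1 : 1 * ln d <= delta * ln d) by nra.
    destruct H1 as [H1 | ->]; [left; now apply exp_increasing | lra]. }
  apply Rle_trans with (L * d); [apply Hl |]. nra.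
- assert (E : 1 <= Rpower d delta).
  { rewrite <- (Rpower_O d) by exact P. apply Rle_Rpower; lra. }
  apply Rle_trans with (2 * B).
  + unfold Rminus. eapply Rle_trans; [apply Rabs_triang |]. rewrite Rabs_Ropp.
    assert (H1 := Hb x). assert (H2 := Hb y). lra.
  + nra.
Qed.

Lemma C1holder_circle_direction delta (beta : circle -> R) (b' b'' : R -> R) B L (v : C2) :
  0 < delta < 1 -> 0 <= B -> 0 <= L ->
  (forall t, is_derive (fun t => beta (cis t)) t (b' t)) -> (forall t, is_derive b' t (b'' t)) ->
  (forall t, Rabs (b' t) <= B) -> (forall t, Rabs (b'' t) <= L) ->
  C1holder_circle delta (fun s => scal (beta s) v).
Proof.
intros Hd HB HL D1 D2 B1 B2.
exists (fun t => scal (b' t) v). split.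
- intros t. apply (is_derive_scal_l (K := R_AbsRing) (V := C2)), D1.
- exists ((L + 2 * B) * norm v). intros x y _ _ N.
  eapply Rle_trans; [right; apply f_equal; symmetry; apply (scal_minus_distr_r (V := C2) (b' x) (b' y) v) |].
  eapply Rle_trans; [apply (norm_scal (V := C2)) |].
  rewrite Rmult_assoc, (Rmult_comm (norm v)), <- Rmult_assoc.
  apply Rmult_le_compat_r; [apply norm_ge_0 |].
  apply (holder_of_bounded_lipschitz b' B L delta Hd HB HL B1); [| exact N].
  exact (lipschitz_of_derive b' b'' L D2 B2).
Qed.

Lemma unit_cis_pow t n : (unit_cis t ^ n)%C = unit_cis (INR n * t).
Proof.
induction n as [|n IH].
- unfold unit_cis. simpl. rewrite Rmult_0_l, cos_0, sin_0. reflexivity.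
- rewrite Cpow_S, IH, S_INR. unfold unit_cis.
  replace ((INR n + 1) * t) with (t + INR n * t) by ring. rewrite cos_plus, sin_plus.
  unfold Cmult; simpl. f_equal; ring.
Qed.

(** In the angular coordinate, [g s^n = cos(n t) g + sin(n t) (i g)], and cosine and sine
    have bounded derivatives of first and second order. *)
Lemma regular_section_monomial delta g n : 0 < delta < 1 ->
  regular_section delta (fun s => (RtoC 0, g * cpt s ^ n)%C).
Proof.
intros Hd. split; [| split].
- assert (E : (fun s : circle => (RtoC 0, g * cpt s ^ n)%C : C2) =
    (fun s => plus (scal (Re (cpt s ^ n)%C) ((RtoC 0, g) : C2)) (scal (Im (cpt s ^ n)%C) ((RtoC 0, Ci * g)%C : C2)))).
  { apply functional_extensionality. intros s. destruct (cpt s ^ n)%C as [x y], g as [p q].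
    unfold_prod. repeat (f_equal; try ring). }
  rewrite E. assert (Pn := pos_INR n). set (N := INR n) in *.
  assert (PN : 0 <= N * N) by nra.
  assert (bound : forall m x, 0 <= m -> -1 <= x <= 1 -> Rabs (m * x) <= m).
  { intros m x Hm Hx. apply Rabs_le. nra. }
  apply C1holder_circle_plus.
  + apply (C1holder_circle_direction delta _ (fun t => N * (- sin (N * t))) (fun t => N * N * (- cos (N * t))) N (N * N)); auto.
    * intros t. apply is_derive_ext with (fun t => cos (N * t)).
      -- intros u. change (cpt (cis u)) with (unit_cis u). now rewrite unit_cis_pow.
      -- auto_derive; [trivial | ring].
    * intros t. auto_derive; [trivial | ring].
    * intros t. assert (H := SIN_bound (N * t)). apply bound; lra.
    * intros t. assert (H := COS_bound (N * t)). apply bound; lra.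
  + apply (C1holder_circle_direction delta _ (fun t => N * cos (N * t)) (fun t => N * N * (- sin (N * t))) N (N * N)); auto.
    * intros t. apply is_derive_ext with (fun t => sin (N * t)).
      -- intros u. change (cpt (cis u)) with (unit_cis u). now rewrite unit_cis_pow.
      -- auto_derive; [trivial | ring].
    * intros t. auto_derive; [trivial | ring].
    * intros t. apply bound; [lra | apply COS_bound].
    * intros t. assert (H := SIN_bound (N * t)). apply bound; lra.
- apply extends_iff. exists (fun _ => RtoC 0). split; [apply disc_algebra_const | reflexivity].
- apply extends_iff. exists (fun z => g * z ^ n)%C. split; [| reflexivity].
  apply disc_algebra_mult; [apply disc_algebra_const | apply disc_algebra_pow].
Qed.

(** * Real trigonometric polynomials on the circle *)

(** The cosines of degrees [0] to [k], then the sines of degrees [1] to [k], in one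
    list: the sine of degree [0] is zero and must be left out. *)
Definition trig_basis (k i : nat) (s : circle) : R :=
  if (i <=? k + 1)%nat then Re (cpt s ^ (i - 1))%C else Im (cpt s ^ (i - k - 1))%C.

Definition Rsum (u : nat -> R) (n : nat) : R := @sum_n_m R_AbelianMonoid u 1 n.

Lemma Rsum_0 u : Rsum u 0 = 0.
Proof. apply (sum_n_m_zero (G := R_AbelianMonoid)). lia. Qed.

Lemma Rsum_S u n : Rsum u (S n) = Rsum u n + u (S n).
Proof. apply (sum_n_Sm (G := R_AbelianMonoid)). lia. Qed.

Lemma Rsum_single u i n : (forall j, (1 <= j <= n)%nat -> j <> i -> u j = 0) ->
  (1 <= i <= n)%nat -> Rsum u n = u i.
Proof.
induction n as [|n IH]; intros H Hi; [lia |].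
rewrite Rsum_S. destruct (Nat.eq_dec i (S n)) as [-> | N].
- replace (Rsum u n) with 0; [ring |].
  assert (E : forall m, (m <= n)%nat -> Rsum u m = 0).
  { induction m as [|m IHm]; intros Hm; [apply Rsum_0 |].
    rewrite Rsum_S, IHm by lia. rewrite H by lia. ring. }
  symmetry. now apply E.
- rewrite IH, (H (S n)); [ring | lia | lia | | lia].
  intros j Hj. apply H. lia.
Qed.

Lemma Rsum_plus u v n : Rsum (fun i => u i + v i) n = Rsum u n + Rsum v n.
Proof. induction n as [|n IH]; [rewrite !Rsum_0; ring | rewrite !Rsum_S, IH; ring]. Qed.

Lemma Rsum_scal r u n : Rsum (fun i => r * u i) n = r * Rsum u n.
Proof. induction n as [|n IH]; [rewrite !Rsum_0; ring | rewrite !Rsum_S, IH; ring]. Qed.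

Lemma Rsum_ext u v n : (forall i, u i = v i) -> Rsum u n = Rsum v n.
Proof. intros H. induction n as [|n IH]; [now rewrite !Rsum_0 | now rewrite !Rsum_S, IH, H]. Qed.

Definition trig_space (k : nat) (beta : circle -> R) : Prop :=
  exists c : nat -> R, forall s, beta s = Rsum (fun i => c i * trig_basis k i s) (2 * k + 1).

Lemma trig_space_ext k b b' : (forall s, b s = b' s) -> trig_space k b -> trig_space k b'.
Proof. intros E [c H]. exists c. intros s. now rewrite <- E. Qed.

Lemma trig_space_plus k b b' : trig_space k b -> trig_space k b' -> trig_space k (fun s => b s + b' s).
Proof.
intros [c H] [c' H']. exists (fun i => c i + c' i). intros s.
rewrite H, H', <- Rsum_plus. apply Rsum_ext. intros i; ring.
Qed.

Lemma trig_space_scal k r b : trig_space k b -> trig_space k (fun s => r * b s).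
Proof.
intros [c H]. exists (fun i => r * c i). intros s.
rewrite H, <- Rsum_scal. apply Rsum_ext. intros i; ring.
Qed.

Lemma trig_space_basis k i : (1 <= i <= 2 * k + 1)%nat -> trig_space k (trig_basis k i).
Proof.
intros Hi. exists (fun j => if Nat.eq_dec j i then 1 else 0). intros s.
rewrite (Rsum_single _ i); [| | exact Hi].
- destruct (Nat.eq_dec i i); [ring | easy].
- intros j _ Hj. destruct (Nat.eq_dec j i); [easy | ring].
Qed.

Lemma trig_space_Re k m : (m <= k)%nat -> trig_space k (fun s => Re (cpt s ^ m)%C).
Proof.
intros Hm. apply trig_space_ext with (trig_basis k (m + 1)); [| apply trig_space_basis; lia].
intros s. unfold trig_basis. rewrite (proj2 (Nat.leb_le _ _)) by lia.
now replace (m + 1 - 1)%nat with m by lia.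
Qed.

Lemma trig_space_Im k m : (m <= k)%nat -> trig_space k (fun s => Im (cpt s ^ m)%C).
Proof.
intros Hm. destruct m as [|m].
- exists (fun _ => 0). intros s. rewrite Rsum_scal. unfold Im; simpl. ring.
- apply trig_space_ext with (trig_basis k (k + 1 + S m)); [| apply trig_space_basis; lia].
  intros s. unfold trig_basis. rewrite (proj2 (Nat.leb_gt _ _)) by lia.
  now replace (k + 1 + S m - k - 1)%nat with (S m) by lia.
Qed.

Lemma Cmod_cpt s : Cmod (cpt s) = 1.
Proof. exact (proj2_sig s). Qed.

Lemma cpt_conj_pow s n : (cpt s ^ n * Cconj (cpt s) ^ n)%C = 1.
Proof. rewrite <- Cpow_mult_l, Cmult_conj_unit by apply Cmod_cpt. apply Cpow_1_l. Qed.

(** On the circle [conj s^k s^j] is [s^(j - k)] or [conj s^(k - j)], of degree at most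
    [k]. *)
Lemma trig_space_monomial k g j : (j <= 2 * k)%nat ->
  trig_space k (fun s => Re (g * (Cconj (cpt s) ^ k * cpt s ^ j))%C).
Proof.
intros Hj. destruct (Nat.le_gt_cases k j) as [H | H].
- apply trig_space_ext with
    (fun s => Re g * Re (cpt s ^ (j - k))%C + (- Im g) * Im (cpt s ^ (j - k))%C).
  + intros s. replace j with (k + (j - k))%nat at 3 by lia. rewrite Cpow_add_r.
    replace (g * (Cconj (cpt s) ^ k * (cpt s ^ k * cpt s ^ (j - k))))%C with
      (g * cpt s ^ (j - k) * (cpt s ^ k * Cconj (cpt s) ^ k))%C by ring.
    rewrite cpt_conj_pow. set (w := (cpt s ^ (j - k))%C). unfold Re, Im; simpl. ring.
  + apply trig_space_plus; apply trig_space_scal; [apply trig_space_Re | apply trig_space_Im]; lia.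
- apply trig_space_ext with
    (fun s => Re g * Re (cpt s ^ (k - j))%C + Im g * Im (cpt s ^ (k - j))%C).
  + intros s. replace k with (j + (k - j))%nat at 3 by lia. rewrite Cpow_add_r.
    replace (g * (Cconj (cpt s) ^ j * Cconj (cpt s) ^ (k - j) * cpt s ^ j))%C with
      (g * Cconj (cpt s) ^ (k - j) * (cpt s ^ j * Cconj (cpt s) ^ j))%C by ring.
    rewrite cpt_conj_pow, <- Cpow_conj. set (w := (cpt s ^ (k - j))%C). unfold Re, Im; simpl. ring.
  + apply trig_space_plus; apply trig_space_scal; [apply trig_space_Re | apply trig_space_Im]; lia.
Qed.

Lemma trig_space_polynomial k g (f : nat -> C) n : (n <= 2 * k + 1)%nat ->
  trig_space k (fun s => Re (g * (Cconj (cpt s) ^ k * Csum (fun j => cpt s ^ j * f j) n))%C).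
Proof.
induction n as [|n IH]; intros Hn.
- exists (fun _ => 0). intros s. rewrite Rsum_scal. unfold Re; simpl. ring.
- eapply trig_space_ext; [| apply (trig_space_plus _ _ _ (IH ltac:(lia)) (trig_space_monomial k (g * f n)%C n ltac:(lia)))].
  intros s. cbv beta.
  assert (A : forall x y : C, Re x + Re y = Re (x + y)%C) by reflexivity.
  rewrite A. f_equal. simpl Csum. ring.
Qed.

Definition defect_section (k i : nat) (s : circle) : C2 :=
  (RtoC 0, Ci * trig_basis k i s * cpt s ^ k)%C.

Lemma defect_section_sum k (c : nat -> R) s n :
  sum_n_m (fun i => scal (c i) (defect_section k i s)) 1 n =
  (RtoC 0, Ci * Rsum (fun i => c i * trig_basis k i s)%R n * cpt s ^ k)%C.
Proof.
induction n as [|n IH].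
- rewrite sum_n_m_zero by lia. rewrite Rsum_0. unfold zero; simpl.
  assert (E : (Ci * 0 * cpt s ^ k)%C = RtoC 0) by ring. rewrite E. reflexivity.
- rewrite sum_n_Sm by lia. rewrite IH, Rsum_S. unfold defect_section.
  set (x := Rsum _ n). set (y := trig_basis k (S n) s). set (r := c (S n)).
  destruct (cpt s ^ k)%C as [p q]. clearbody x y r.
  unfold_prod. repeat (f_equal; try ring).
Qed.

Lemma sin_2PI_nat n : sin (INR n * (2 * PI)) = 0.
Proof.
replace (INR n * (2 * PI)) with (0 + 2 * INR n * PI) by ring. rewrite sin_period. apply sin_0.
Qed.

Lemma cos_2PI_nat n : cos (INR n * (2 * PI)) = 1.
Proof.
replace (INR n * (2 * PI)) with (0 + 2 * INR n * PI) by ring. rewrite cos_period. apply cos_0.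
Qed.

Lemma is_RInt_constant (a b c v : R) : v = (b - a) * c -> is_RInt (fun _ => c) a b v.
Proof. intros ->. apply (is_RInt_const (V := R_NormedModule)). Qed.

Lemma is_RInt_cos a : sin (a * (2 * PI)) = 0 ->
  exists v : R, is_RInt (fun t => cos (a * t)) 0 (2 * PI) v /\ (a = 0 -> v = 2 * PI) /\ (a <> 0 -> v = 0).
Proof.
intros Ha. destruct (Req_dec a 0) as [-> | N].
- exists (2 * PI). split; [| split; easy].
  apply is_RInt_ext with (fun _ => 1).
  + intros t _. now rewrite Rmult_0_l, cos_0.
  + apply is_RInt_constant. ring.
- exists 0. split; [| split; easy].
  replace 0 with (minus (sin (a * (2 * PI)) / a) (sin (a * 0) / a)) at 2.
  + apply (is_RInt_derive (V := R_CompleteNormedModule) (fun t => sin (a * t) / a) (fun t => cos (a * t))).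
    * intros t _. auto_derive; [trivial | field; exact N].
    * intros t _. apply (ex_derive_continuous (K := R_AbsRing) (V := R_NormedModule)). auto_derive. trivial.
  + rewrite Ha, Rmult_0_r, sin_0. unfold minus, plus, opp; simpl. field. exact N.
Qed.

Lemma is_RInt_sin a : cos (a * (2 * PI)) = 1 -> is_RInt (fun t => sin (a * t)) 0 (2 * PI) 0.
Proof.
intros Ha. destruct (Req_dec a 0) as [-> | N].
- apply is_RInt_ext with (fun _ => 0).
  + intros t _. now rewrite Rmult_0_l, sin_0.
  + apply is_RInt_constant. ring.
- replace 0 with (minus (- cos (a * (2 * PI)) / a) (- cos (a * 0) / a)) at 2.
  + apply (is_RInt_derive (V := R_CompleteNormedModule) (fun t => - cos (a * t) / a) (fun t => sin (a * t))).
    * intros t _. auto_derive; [trivial | field; exact N].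
    * intros t _. apply (ex_derive_continuous (K := R_AbsRing) (V := R_NormedModule)). auto_derive. trivial.
  + rewrite Ha, Rmult_0_r, cos_0. unfold minus, plus, opp; simpl. field. exact N.
Qed.

Lemma is_RInt_lin_comb f g h u v p q w : w = p * u + q * v -> is_RInt f 0 (2 * PI) u -> is_RInt g 0 (2 * PI) v ->
  (forall t, h t = p * f t + q * g t) -> is_RInt h 0 (2 * PI) w.
Proof.
intros -> Hf Hg E. apply is_RInt_ext with (fun t => p * f t + q * g t); [intros t _; now rewrite E |].
apply (is_RInt_plus (V := R_NormedModule) (fun t => p * f t) (fun t => q * g t));
  apply (is_RInt_scal (V := R_NormedModule)); assumption.
Qed.

Lemma trig_orthogonality (j m : nat) :
  (exists v : R, is_RInt (fun t => cos (INR j * t) * cos (INR m * t)) 0 (2 * PI) v /\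
     (j = m -> v <> 0) /\ (j <> m -> v = 0)) /\
  ((0 < j)%nat -> exists v : R, is_RInt (fun t => sin (INR j * t) * sin (INR m * t)) 0 (2 * PI) v /\
     (j = m -> v <> 0) /\ (j <> m -> v = 0)) /\
  is_RInt (fun t => sin (INR j * t) * cos (INR m * t)) 0 (2 * PI) 0.
Proof.
assert (HPI := PI_RGT_0).
assert (S1 := sin_2PI_nat j). assert (C1 := cos_2PI_nat j).
assert (S2 := sin_2PI_nat m). assert (C2 := cos_2PI_nat m).
destruct (is_RInt_cos (INR j - INR m)) as (vm & Im0 & Im1 & Im2).
{ replace ((INR j - INR m) * (2 * PI)) with (INR j * (2 * PI) - INR m * (2 * PI)) by ring.
  rewrite sin_minus, S1, S2. ring. }
destruct (is_RInt_cos (INR j + INR m)) as (vp & Ip0 & Ip1 & Ip2).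
{ rewrite Rmult_plus_distr_r, sin_plus, S1, S2. ring. }
assert (Hjm : j <> m -> INR j - INR m <> 0).
{ intros N E. apply N, INR_eq. lra. }
assert (Hpos : forall n : nat, (0 < n)%nat -> 0 < INR n) by (intros n Hn; now apply lt_0_INR).
assert (Pj := pos_INR j). assert (Pm := pos_INR m).
split; [| split].
- exists (/ 2 * vm + / 2 * vp). split; [| split].
  + apply (is_RInt_lin_comb _ _ _ _ _ _ _ _ eq_refl Im0 Ip0). intros t.
    rewrite Rmult_minus_distr_r, Rmult_plus_distr_r, cos_minus, cos_plus. field.
  + intros ->. rewrite Im1 by ring.
    destruct (Req_dec (INR m + INR m) 0) as [E | E]; [rewrite Ip1 | rewrite Ip2]; try exact E; lra.
  + intros N. rewrite Im2 by now apply Hjm. rewrite Ip2; [ring |].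
    intros E. apply N, INR_eq. lra.
- intros Hj. specialize (Hpos j Hj). exists (/ 2 * vm + - / 2 * vp). split; [| split].
  + apply (is_RInt_lin_comb _ _ _ _ _ _ _ _ eq_refl Im0 Ip0). intros t.
    rewrite Rmult_minus_distr_r, Rmult_plus_distr_r, cos_minus, cos_plus. field.
  + intros <-. rewrite Im1 by ring. rewrite Ip2; lra.
  + intros N. rewrite Im2 by now apply Hjm. rewrite Ip2; [ring | lra].
- apply (is_RInt_lin_comb (fun t => sin ((INR j + INR m) * t)) (fun t => sin ((INR j - INR m) * t))
    _ 0 0 (/ 2) (/ 2)); [ring | | |].
  + apply is_RInt_sin. rewrite Rmult_plus_distr_r, cos_plus, S1, S2, C1, C2. ring.
  + apply is_RInt_sin. rewrite Rmult_minus_distr_r, cos_minus, S1, S2, C1, C2. ring.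
  + intros t. rewrite Rmult_minus_distr_r, Rmult_plus_distr_r, sin_minus, sin_plus. field.
Qed.

Lemma trig_basis_cis k i t : trig_basis k i (cis t) =
  if (i <=? k + 1)%nat then cos (INR (i - 1) * t) else sin (INR (i - k - 1) * t).
Proof.
unfold trig_basis. change (cpt (cis t)) with (unit_cis t). rewrite !unit_cis_pow. reflexivity.
Qed.

Lemma trig_basis_orthogonal k i m : (1 <= i)%nat -> (1 <= m)%nat ->
  exists v : R, is_RInt (fun t => trig_basis k i (cis t) * trig_basis k m (cis t)) 0 (2 * PI) v /\
    (i = m -> v <> 0) /\ (i <> m -> v = 0).
Proof.
intros Hi Hm.
destruct (Nat.leb_spec i (k + 1)) as [Li | Li]; destruct (Nat.leb_spec m (k + 1)) as [Lm | Lm].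
- destruct (trig_orthogonality (i - 1) (m - 1)) as [(v & H & H1 & H2) _].
  exists v. split; [| split; intros E; [apply H1 | apply H2]; lia].
  eapply is_RInt_ext; [| exact H]. intros t _. rewrite !trig_basis_cis.
  now rewrite (proj2 (Nat.leb_le _ _) Li), (proj2 (Nat.leb_le _ _) Lm).
- destruct (trig_orthogonality (m - k - 1) (i - 1)) as (_ & _ & H).
  exists 0. split; [| split; [lia | easy]].
  eapply is_RInt_ext; [| exact H]. intros t _. rewrite !trig_basis_cis.
  rewrite (proj2 (Nat.leb_le _ _) Li), (proj2 (Nat.leb_gt _ _) Lm). apply Rmult_comm.
- destruct (trig_orthogonality (i - k - 1) (m - 1)) as (_ & _ & H).
  exists 0. split; [| split; [lia | easy]].
  eapply is_RInt_ext; [| exact H]. intros t _. rewrite !trig_basis_cis.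
  now rewrite (proj2 (Nat.leb_gt _ _) Li), (proj2 (Nat.leb_le _ _) Lm).
- destruct (trig_orthogonality (i - k - 1) (m - k - 1)) as (_ & H & _).
  destruct (H ltac:(lia)) as (v & H0 & H1 & H2).
  exists v. split; [| split; intros E; [apply H1 | apply H2]; lia].
  eapply is_RInt_ext; [| exact H0]. intros t _. rewrite !trig_basis_cis.
  now rewrite (proj2 (Nat.leb_gt _ _) Li), (proj2 (Nat.leb_gt _ _) Lm).
Qed.

(** Integrating a vanishing combination against the basis function of index [m] leaves
    [c m] times a nonzero number. *)
Lemma trig_basis_free k (c : nat -> R) n :
  (forall s, Rsum (fun i => c i * trig_basis k i s) n = 0) ->
  forall m, (1 <= m <= n)%nat -> c m = 0.
Proof.
intros H m Hm.
assert (K : forall N, exists w : nat -> R,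
  is_RInt (fun t => Rsum (fun i => c i * trig_basis k i (cis t)) N * trig_basis k m (cis t)) 0 (2 * PI)
    (Rsum (fun i => c i * w i) N) /\
  forall i, (1 <= i <= N)%nat -> (i = m -> w i <> 0) /\ (i <> m -> w i = 0)).
{ induction N as [|N (w & HI & HW)].
  - exists (fun _ => 0). split; [| lia]. rewrite Rsum_0.
    apply is_RInt_ext with (fun _ => 0); [intros t _; rewrite Rsum_0; symmetry; apply Rmult_0_l |].
    apply is_RInt_constant. ring.
  - destruct (trig_basis_orthogonal k (S N) m ltac:(lia) ltac:(lia)) as (v & Hv & V1 & V2).
    exists (fun i => if Nat.eq_dec i (S N) then v else w i). split.
    + rewrite Rsum_S. destruct (Nat.eq_dec (S N) (S N)) as [_ | E]; [| easy].
      replace (Rsum (fun i => c i * (if Nat.eq_dec i (S N) then v else w i)) N) with (Rsum (fun i => c i * w i) N).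
      * refine (is_RInt_lin_comb _ _ _ _ _ 1 (c (S N)) _ _ HI Hv _); [ring |].
        intros t. rewrite Rsum_S. ring.
      * assert (G : forall M, (M <= N)%nat -> Rsum (fun i => c i * w i) M =
          Rsum (fun i => c i * (if Nat.eq_dec i (S N) then v else w i)) M).
        { induction M as [|M IHM]; intros HM; [now rewrite !Rsum_0 |].
          rewrite !Rsum_S, IHM by lia. destruct (Nat.eq_dec (S M) (S N)); [lia | reflexivity]. }
        now apply G.
    + intros i Hi. destruct (Nat.eq_dec i (S N)) as [-> | N']; [split; assumption | apply HW; lia]. }
destruct (K n) as (w & HI & HW).
assert (E0 : Rsum (fun i => c i * w i) n = 0).
{ apply (is_RInt_unique (V := R_CompleteNormedModule)) in HI. rewrite <- HI.
  rewrite (RInt_ext _ (fun _ => 0)); [| intros t _; rewrite H; apply Rmult_0_l].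
  rewrite RInt_const. unfold scal; simpl; unfold mult; simpl. ring. }
rewrite (Rsum_single _ m) in E0; [| | exact Hm].
- destruct (HW m Hm) as [W _]. specialize (W eq_refl).
  apply Rmult_integral in E0. tauto.
- intros j Hj N. rewrite (proj2 (HW j Hj) N). ring.
Qed.

(** * The space of extendable sections *)

(** [2 Re (g s^m) s^k = g s^(k + m) + conj g s^(k - m)] on the circle, and [m <= k]: both
    exponents are nonnegative, so the section is a polynomial in [s]. *)
Lemma defect_section_regular delta k i : 0 < delta < 1 -> (1 <= i <= 2 * k + 1)%nat ->
  regular_section delta (defect_section k i).
Proof.
intros Hd Hi.
assert (K : forall g m, (m <= k)%nat -> regular_section delta
  (fun s => (RtoC 0, Ci * Re (g * cpt s ^ m)%C * cpt s ^ k)%C)).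
{ intros g m Hm.
  replace (fun s : circle => (RtoC 0, Ci * Re (g * cpt s ^ m)%C * cpt s ^ k)%C : C2) with
    (fun s : circle => plus ((RtoC 0, Ci * g / 2 * cpt s ^ (k + m))%C : C2)
       ((RtoC 0, Ci * Cconj g / 2 * cpt s ^ (k - m))%C : C2)).
  - apply regular_section_plus; now apply regular_section_monomial.
  - apply functional_extensionality. intros s. apply injective_projections.
    + apply (plus_zero_l (G := C_R_NormedModule) zero).
    + change (Ci * g / 2 * cpt s ^ (k + m) + Ci * Cconj g / 2 * cpt s ^ (k - m) =
        Ci * Re (g * cpt s ^ m)%C * cpt s ^ k)%C.
      replace (RtoC (Re (g * cpt s ^ m)%C)) with ((g * cpt s ^ m + Cconj (g * cpt s ^ m)) / 2)%C.
      * rewrite Cmult_conj, Cpow_conj. replace k with (m + (k - m))%nat at 3 by lia.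
        rewrite !Cpow_add_r. replace (cpt s ^ k)%C with (cpt s ^ m * cpt s ^ (k - m))%C
          by (rewrite <- Cpow_add_r; f_equal; lia).
        assert (H := cpt_conj_pow s m).
        set (w := (cpt s ^ m)%C) in *. set (v := (Cconj (cpt s) ^ m)%C) in *.
        set (x := (cpt s ^ (k - m))%C).
        transitivity (Ci * g / 2 * w * x * w + Ci * Cconj g / 2 * x * (w * v))%C; [rewrite H; field | field].
      * destruct (g * cpt s ^ m)%C as [x y]. unfold Cdiv, Cinv, Cconj, Cplus, Cmult, RtoC; simpl.
        f_equal; field. }
unfold defect_section, trig_basis. destruct (Nat.leb_spec i (k + 1)) as [L | L].
- replace (fun s : circle => (RtoC 0, Ci * Re (cpt s ^ (i - 1))%C * cpt s ^ k)%C : C2) with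
    (fun s : circle => (RtoC 0, Ci * Re (1 * cpt s ^ (i - 1))%C * cpt s ^ k)%C : C2).
  + apply K. lia.
  + apply functional_extensionality. intros s. now rewrite Cmult_1_l.
- replace (fun s : circle => (RtoC 0, Ci * Im (cpt s ^ (i - k - 1))%C * cpt s ^ k)%C : C2) with
    (fun s : circle => (RtoC 0, Ci * Re (- Ci * cpt s ^ (i - k - 1))%C * cpt s ^ k)%C : C2).
  + apply K. lia.
  + apply functional_extensionality. intros s. do 4 f_equal. unfold Re, Im; simpl. ring.
Qed.

Lemma regular_section_sum delta (c : nat -> R) (e : nat -> circle -> C2) n : 0 < delta < 1 ->
  (forall i, (1 <= i <= n)%nat -> regular_section delta (e i)) ->
  regular_section delta (fun s => sum_n_m (fun i => scal (c i) (e i s)) 1 n).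
Proof.
intros Hd. induction n as [|n IH]; intros He.
- replace (fun s => sum_n_m (fun i => scal (c i) (e i s)) 1 0) with
    (fun s : circle => (RtoC 0, 0 * cpt s ^ 0)%C : C2).
  + now apply regular_section_monomial.
  + apply functional_extensionality. intros s. rewrite sum_n_m_zero by lia.
    rewrite Cmult_0_l. reflexivity.
- replace (fun s => sum_n_m (fun i => scal (c i) (e i s)) 1 (S n)) with
    (fun s => plus (sum_n_m (fun i => scal (c i) (e i s)) 1 n) (scal (c (S n)) (e (S n) s))).
  + apply regular_section_plus; [apply IH; intros; apply He; lia |].
    apply regular_section_scal, He. lia.
  + apply functional_extensionality. intros s. now rewrite sum_n_Sm by lia.
Qed.

(** The extension [F] of [a2 = i c s^k], [c] real, satisfies the symmetry of
    [fourier_expansion_circle], and [c = Re (- i conj s^k F)]. *)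
Lemma defect_space_coefficients delta k a : defect_space delta (Mk k) flat_disc a ->
  exists c : nat -> R, forall s,
    a s = (RtoC 0, Ci * Rsum (fun i => c i * trig_basis k i s)%R (2 * k + 1) * cpt s ^ k)%C.
Proof.
intros (Hcon & _ & _ & Hext).
assert (Hform : forall s, fst (a s) = RtoC 0 /\ exists c : R, snd (a s) = (Ci * c * cpt s ^ k)%C).
{ intros s. apply (conormal_Mk_flat k (cpt s)); [apply Cmod_cpt |].
  rewrite <- surjective_pairing. apply Hcon. }
apply extends_iff in Hext. destruct Hext as (F & HF & HFa).
assert (Hsym : forall t, F (unit_cis t) = (- (Cconj (F (unit_cis t)) * unit_cis t ^ (2 * k)))%C).
{ intros t. change (unit_cis t) with (cpt (cis t)). set (s := cis t). rewrite HFa.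
  destruct (proj2 (Hform s)) as [c ->].
  assert (H := cpt_conj_pow s k).
  rewrite !Cmult_conj, Cpow_conj. replace (2 * k)%nat with (k + k)%nat by lia. rewrite Cpow_add_r.
  replace (Cconj Ci) with (- Ci)%C by (unfold Cconj, Ci, Copp; simpl; f_equal; ring).
  replace (Cconj c) with (RtoC c) by (unfold Cconj, RtoC; simpl; f_equal; ring).
  set (w := (cpt s ^ k)%C) in *. set (v := (Cconj (cpt s) ^ k)%C) in *.
  transitivity (Ci * c * w * (w * v))%C; [rewrite H; ring | ring]. }
assert (Hb : trig_space k (fun s => Re (- Ci * (Cconj (cpt s) ^ k *
  Csum (fun j => cpt s ^ j * fourier_coef F j) (2 * k + 1)))%C)) by (apply trig_space_polynomial; lia).
destruct Hb as [c Hc]. exists c. intros s. rewrite <- Hc.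
rewrite (surjective_pairing (a s)), (proj1 (Hform s)). f_equal.
replace (2 * k + 1)%nat with (S (2 * k)) by lia.
rewrite <- (fourier_expansion_circle F (2 * k) (cpt s) HF Hsym (Cmod_cpt s)), HFa.
destruct (proj2 (Hform s)) as [r ->].
assert (H := cpt_conj_pow s k).
f_equal. f_equal. f_equal.
set (w := (cpt s ^ k)%C) in *. set (v := (Cconj (cpt s) ^ k)%C) in *.
transitivity (Re (- Ci * Ci * r * (w * v))%C); [rewrite H; unfold Re; simpl; ring |].
f_equal. ring.
Qed.

Lemma defect_space_flat_disc delta k a : 0 < delta < 1 ->
  defect_space delta (Mk k) flat_disc a <->
  exists c : nat -> R, forall s,
    a s = sum_n_m (fun i => scal (c i) (defect_section k i s)) 1 (2 * k + 1).
Proof.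
intros Hd. split.
- intros Ha. destruct (defect_space_coefficients _ _ _ Ha) as [c Hc].
  exists c. intros s. rewrite defect_section_sum. apply Hc.
- intros [c Hc].
  assert (E : a = fun s => sum_n_m (fun i => scal (c i) (defect_section k i s)) 1 (2 * k + 1))
    by (apply functional_extensionality; exact Hc).
  rewrite E. clear a Hc E.
  split; [| apply regular_section_sum; [exact Hd | intros i Hi; now apply defect_section_regular]].
  intros s. rewrite defect_section_sum. apply conormal_Mk_flat; [apply Cmod_cpt |].
  split; [reflexivity |]. eexists; reflexivity.
Qed.

Lemma defect_section_free k (c : nat -> R) n :
  (forall s, sum_n_m (fun i => scal (c i) (defect_section k i s)) 1 n = zero) ->
  forall i, (1 <= i <= n)%nat -> c i = 0.
Proof.
intros H. apply (trig_basis_free k). intros s.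
specialize (H s). rewrite defect_section_sum in H. apply (f_equal snd) in H.
set (r := Rsum _ n) in *. clearbody r. change (Ci * r * cpt s ^ k = RtoC 0)%C in H.
assert (E := cpt_conj_pow s k).
assert (E' : (Ci * r)%C = RtoC 0).
{ transitivity (Ci * r * (cpt s ^ k * Cconj (cpt s) ^ k))%C; [rewrite E; ring |].
  rewrite Cmult_assoc, H. ring. }
unfold Cmult, RtoC, Ci in E'; simpl in E'. injection E'. intros. lra.
Qed.

Theorem proposition1 :
  forall (k : nat) (delta : R),
    (0 < k)%nat -> 0 < delta < 1 ->
    real_hypersurface (Mk k) /\
    attached_disc delta (Mk k) flat_disc /\
    has_defect delta (Mk k) flat_disc (2 * k + 1).
Proof.
intros k delta _ Hd. split; [| split].
- apply Mk_real_hypersurface.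
- apply flat_disc_attached.
- exists (defect_section k). split.
  + intros a. now apply defect_space_flat_disc.
  + intros c. apply defect_section_free.
Qed.
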